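(* Let $R$ be a discrete valuation ring with uniformizing parameter $t$ and residue field $K=R/(t)$. The stable category $\underline{\mathcal{F}}_\pi$ of the Frobenius category $\mathcal{F}_\pi$ is equivalent, as a $K$-category, to the continuous cluster category $\mathcal{C}_\pi$ over $K$.
   Context: $S^1=\mathbb{R}/2\pi\mathbb{Z}$, and for $x\in\mathbb{R}$ the class of $x$ in $S^1$ is $[x]$. A representation $V$ of $S^1$ over $R$ consists of an $R$-module $V[x]$ for every $[x]\in S^1$ and an $R$-linear map $V^{(x,\alpha)}:V[x]\to V[x-\alpha]$ for every $[x]\in S^1$ and real $\alpha\ge 0$ (depending only on $[x]$ and $\alpha$), such that $V^{(x-\beta,\alpha)}\circ V^{(x,\beta)}=V^{(x,\alpha+\beta)}$ for all $\alpha,\beta\ge 0$, and $V^{(x,2\pi n)}:V[x]\to V[x]$ is multiplication by $t^n$ for all $n\in\mathbb{N}$. A morphism $f:V\to W$ is a family of $R$-linear maps $f_{[x]}:V[x]\to W[x]$ with $W^{(x,\alpha)}f_{[x]}=f_{[x-\alpha]}V^{(x,\alpha)}$. Monomorphisms, epimorphisms, exactness and direct sums are taken pointwise; a representation is projective if morphisms from it lift through all epimorphisms. $P_{[x]}$ is the representation with $P_{[x]}[x-\alpha]=Re_x^\alpha$ free on one generator $e_x^\alpha$ for $0\le\alpha<2\pi$; for $n\in\mathbb{N}$ put $e_x^{\gamma+2\pi n}:=t^ne_x^\gamma$; the structure maps are $P_{[x]}^{(x-\alpha,\beta)}(e_x^\alpha)=e_x^{\alpha+\beta}$. A representation is finitely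 generated if it is a quotient of a finite direct sum of representations $P_{[x_i]}$. $\mathcal{P}_{S^1}$ is the category of all finitely generated projective representations of $S^1$ over $R$. The category $\mathcal{F}_\pi$: objects are pairs $(V,d)$ with $V\in\mathcal{P}_{S^1}$ and $d:V\to V$ an endomorphism with $d^2=t$ (multiplication by $t$); morphisms $(V,d)\to(W,d)$ are morphisms $f:V\to W$ with $fd=df$. Exact sequences in $\mathcal{F}_\pi$ are the sequences $(X,d)\xrightarrow{f}(Y,d)\xrightarrow{g}(Z,d)$ such that $0\to X\xrightarrow{f}Y\xrightarrow{g}Z\to 0$ is exact (hence split exact) in $\mathcal{P}_{S^1}$. This is a Frobenius category. Its stable category $\underline{\mathcal{F}}_\pi$ has the same objects, with morphism sets the quotients of those of $\mathcal{F}_\pi$ modulo morphisms factoring through projective-injective objects; multiplication by $t$ is zero in it, so it is a $K$-category. The continuous cluster category $\mathcal{C}_\pi$ over a field $K$ is the additive category (formal finite direct sums, matrices of morphisms) generated by the $K$-category $\widetilde{Ind}\,\mathcal{C}_\pi$ defined as follows. Objects: ordered pairs of distinct points of $S^1$, labeled by pairs of real numbers $(x,y)$ with $x<y<x+2\pi$, where $(x,y)=(x+2\pi n,y+2\pi n)$ for all integers $n$. Morphisms: for objects $X,Y$, $\mathcal{C}_\pi(X,Y)$ is a one-dimensional $K$-vector space if coordinates $X=(x_0,x_1)$, $Y=(y_0,y_1)$ can be chosen to satisfy either $x_0\le y_0<x_1\le y_1<x_0+2\pi$ (generator denoted $b_+^{XY}$) or $x_0\le y_1<x_1\le y_0+2\pi<x_0+2\pi$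 (generator denoted $b_-^{XY}$); otherwise $\mathcal{C}_\pi(X,Y)=0$. Composition: the composition of $rb_\epsilon^{XY}:X\to Y$ and $sb_{\epsilon'}^{YZ}:Y\to Z$ ($r,s\in K$, $\epsilon,\epsilon'\in\{+,-\}$) is $rs\,b_{\epsilon\epsilon'}^{XZ}$ if $\mathcal{C}_\pi(X,Z)$ is nonzero with generator $b_{\epsilon\epsilon'}^{XZ}$, and zero otherwise. *)

(* Defs.v *)
From HB Require Import structures.
From mathcomp Require Import all_boot all_order all_algebra.
From mathcomp Require Import generic_quotient ring_quotient.
From mathcomp Require Import all_classical all_reals all_analysis.
From mathcomp Require Import ring lra.

Set Implicit Arguments.
Unset Strict Implicit.
Unset Printing Implicit Defensive.

Import Order.TTheory GRing.Theory Num.Theory.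
Local Open Scope ring_scope.
Local Open Scope quotient_scope.

Section DVR.
Variable R : idomainType.

Definition is_ideal (I : set R) : Prop :=
  I 0 /\ forall a x y, I x -> I y -> I (a * x + y).

Definition principal (g : R) : set R := [set x | exists a, x = a * g].

Definition prime_ideal (I : set R) : Prop :=
  [/\ is_ideal I, ~ I 1 & forall x y, I (x * y) -> I x \/ I y].

Definition maximal_ideal (I : set R) : Prop :=
  [/\ is_ideal I, ~ I 1 &
    forall J : set R, is_ideal J -> ~ J 1 -> (I `<=` J)%classic -> J = I].

(* A principal ideal domain with exactly one nonzero prime ideal. *)
Definition is_dvr : Prop :=
  (forall I, is_ideal I -> exists g, I = principal g) /\
  (exists! I, prime_ideal I /\ I <> [set 0]%classic).

Definition uniformizer (t : R) : Prop := maximal_ideal (principal t).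

(* A field [K] presented as the quotient [R / (t)]. *)
Record residue_map (t : R) (K : fieldType) := ResidueMap {
  rmap :> {rmorphism R -> K};
  rmap_surj : forall a, exists r, rmap r = a;
  rmap_ker : forall r, rmap r = 0 <-> principal t r }.

End DVR.

Section Modules.
Variable k : nzRingType.

Section MkLinear.
Variables (U V : lmodType k) (f : U -> V) (fP : linear f).
Definition linmap := fun of linear f => f.
HB.instance Definition _ := GRing.isLinear.Build k U V *:%R (linmap fP) fP.
Definition mk_linear : {linear U -> V} := linmap fP.
End MkLinear.

Lemma linear_eq (U V : lmodType k) (f g : {linear U -> V}) : f =1 g -> f = g.
Proof.
case: f g => [f [[fB] [fZ]]] [g [[gB] [gZ]]] /= /funext e.
move: gB gZ; rewrite -e => gB gZ.
by rewrite (Prop_irrelevance gB fB) (Prop_irrelevance gZ fZ).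
Qed.

(* For a finite index type this is the direct sum. *)
Definition dsum (I : Type) (V : I -> lmodType k) : Type := forall i, V i.

Section DirectSum.
Variables (I : Type) (V : I -> lmodType k).
Implicit Types v w : dsum V.
HB.instance Definition _ := gen_eqMixin (dsum V).
HB.instance Definition _ := gen_choiceMixin (dsum V).
Let zero : dsum V := fun i => 0.
Let opp v : dsum V := fun i => - v i.
Let add v w : dsum V := fun i => v i + w i.
Let addA : associative add.
Proof. by move=> u v w; apply: functional_extensionality_dep => i; apply: addrA. Qed.
Let addC : commutative add.
Proof. by move=> u v; apply: functional_extensionality_dep => i; apply: addrC. Qed.
Let add0 : left_id zero add.
Proof. by move=> v; apply: functional_extensionality_dep => i; apply: add0r. Qed.
Let addN : left_inverse zero opp add.
Proof. by move=> v; apply: functional_extensionality_dep => i; apply: addNr. Qed.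
HB.instance Definition _ := GRing.isZmodule.Build (dsum V) addA addC add0 addN.
Let scale (a : k) v : dsum V := fun i => a *: v i.
Let scaleA a b v : scale a (scale b v) = scale (a * b) v.
Proof. by apply: functional_extensionality_dep => i; apply: scalerA. Qed.
Let scale1 : left_id 1 scale.
Proof. by move=> v; apply: functional_extensionality_dep => i; apply: scale1r. Qed.
Let scaleDr : right_distributive scale +%R.
Proof. by move=> a u v; apply: functional_extensionality_dep => i; apply: scalerDr. Qed.
Let scaleDl v : {morph scale^~ v : a b / a + b}.
Proof. by move=> a b; apply: functional_extensionality_dep => i; apply: scalerDl. Qed.
HB.instance Definition _ := GRing.Zmodule_isLmodule.Build k (dsum V)
  scaleA scale1 scaleDr scaleDl.

Lemma dsumP v w : (forall i, v i = w i) -> v = w.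
Proof. exact: functional_extensionality_dep. Qed.

End DirectSum.

Section QuotientModule.
Variables (M : lmodType k) (S : {pred M}) (SP : submod_closed S).
Definition submodule := fun of submod_closed S => S.
Local Notation I := (submodule SP).
HB.instance Definition _ := GRing.isSubmodClosed.Build k M I SP.

Definition quotmod := Quotient.quot I.
HB.instance Definition _ := GRing.Zmodule.on quotmod.

Definition qpi (x : M) : quotmod := \pi_(Quotient.quot I) x.
Definition qrepr (x : quotmod) : M := repr (x : Quotient.quot I).

Lemma qreprK x : qpi (qrepr x) = x. Proof. exact: reprK. Qed.
Lemma qpiE x y : (qpi x = qpi y) <-> (x - y \in I).
Proof. by rewrite Quotient.idealrBE; split => [e|/eqP//]; apply/eqP. Qed.
Lemma qpiD x y : qpi (x + y) = qpi x + qpi y.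
Proof. by rewrite /qpi raddfD. Qed.
Lemma qrepr_pi x : qrepr (qpi x) - x \in I.
Proof. by apply/qpiE; rewrite qreprK. Qed.

Definition qscale (a : k) (x : quotmod) : quotmod := qpi (a *: qrepr x).
Lemma qscaleE a x : qscale a (qpi x) = qpi (a *: x).
Proof. by apply/qpiE; rewrite -scalerBr rpredZ // qrepr_pi. Qed.
Let scaleA a b x : qscale a (qscale b x) = qscale (a * b) x.
Proof. by rewrite -[x]qreprK !qscaleE scalerA. Qed.
Let scale1 : left_id 1 qscale.
Proof. by move=> x; rewrite -[x]qreprK qscaleE scale1r. Qed.
Let scaleDr : right_distributive qscale +%R.
Proof.
by move=> a x y; rewrite -[x]qreprK -[y]qreprK -qpiD !qscaleE -qpiD scalerDr.
Qed.
Let scaleDl x : {morph qscale^~ x : a b / a + b}.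
Proof. by move=> a b; rewrite -[x]qreprK !qscaleE -qpiD scalerDl. Qed.
HB.instance Definition _ := GRing.Zmodule_isLmodule.Build k quotmod
  scaleA scale1 scaleDr scaleDl.

Lemma qpiZ a x : qpi (a *: x) = a *: qpi x.
Proof. by rewrite -qscaleE. Qed.

End QuotientModule.
End Modules.

(* A module annihilated by [t] is a vector space over [K = R / (t)]. *)
Section ResidueModule.
Variables (R : idomainType) (t : R) (K : fieldType) (red : residue_map t K).

Definition rlift (a : K) : R := sval (cid (rmap_surj red a)).
Lemma rliftK a : red (rlift a) = a. Proof. by rewrite /rlift; case: cid. Qed.

Variables (M : lmodType R) (tM : forall m : M, t *: m = 0).
Definition resmod :=
  fun (_ : residue_map t K) (_ : forall m : M, t *: m = 0) => (M : Type).
HB.instance Definition _ := GRing.Zmodule.on (resmod red tM).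

Lemma red_scale r s (m : M) : red r = red s -> r *: m = s *: m.
Proof.
move=> e; have /rmap_ker[a ea] : red (r - s) = 0 by rewrite rmorphB e subrr.
by apply/eqP; rewrite -subr_eq0 -scalerBl ea -scalerA tM scaler0.
Qed.

Let scale (a : K) (m : resmod red tM) : resmod red tM := rlift a *: (m : M).
Let scaleA a b m : scale a (scale b m) = scale (a * b) m.
Proof. by rewrite /scale scalerA; apply: red_scale; rewrite rmorphM !rliftK. Qed.
Let scale1 : left_id 1 scale.
Proof.
move=> m; rewrite /scale -[RHS](scale1r (m : M)).
by apply: red_scale; rewrite rliftK rmorph1.
Qed.
Let scaleDr : right_distributive scale +%R.
Proof. by move=> a m n; apply: scalerDr. Qed.
Let scaleDl m : {morph scale^~ m : a b / a + b}.
Proof.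
move=> a b; rewrite /scale -[RHS](scalerDl (m : M)).
by apply: red_scale; rewrite rmorphD !rliftK.
Qed.
HB.instance Definition _ := GRing.Zmodule_isLmodule.Build K (resmod red tM)
  scaleA scale1 scaleDr scaleDl.

End ResidueModule.

Record lincat (k : nzRingType) := LinCat {
  obj :> Type;
  hom : obj -> obj -> lmodType k;
  idm : forall X, hom X X;
  comp : forall X Y Z, hom Y Z -> hom X Y -> hom X Z;
  comp_linl : forall X Y Z (f : hom X Y), linear (fun g : hom Y Z => comp g f);
  comp_linr : forall X Y Z (g : hom Y Z), linear (fun f : hom X Y => comp g f);
  compA : forall X Y Z W (h : hom Z W) (g : hom Y Z) (f : hom X Y),
    comp h (comp g f) = comp (comp h g) f;
  comp1m : forall X Y (f : hom X Y), comp (idm Y) f = f;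
  compm1 : forall X Y (f : hom X Y), comp f (idm X) = f }.

Arguments hom {k} _ _ _.
Arguments idm {k _} X.
Arguments comp {k _ X Y Z} _ _.

Section Equivalence.
Variable k : nzRingType.

Record linfunctor (C D : lincat k) := LinFunctor {
  fob :> C -> D;
  fmap : forall X Y, {linear hom C X Y -> hom D (fob X) (fob Y)};
  fmap1 : forall X, fmap X X (idm X) = idm (fob X);
  fmapM : forall X Y Z (g : hom C Y Z) (f : hom C X Y),
    fmap X Z (comp g f) = comp (fmap Y Z g) (fmap X Y f) }.
Arguments fmap {C D} _ {X Y}.

Definition functor_id (C : lincat k) : linfunctor C C :=
  @LinFunctor C C id (fun X Y => idfun) (fun=> erefl) (fun _ _ _ _ _ => erefl).

Section FunctorComp.
Variables (C D E : lincat k) (G : linfunctor D E) (F : linfunctor C D).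
Let fc X Y : {linear hom C X Y -> hom E (G (F X)) (G (F Y))} :=
  fmap G \o fmap F.
Let fc1 X : fc X X (idm X) = idm (G (F X)).
Proof. by rewrite /= !fmap1. Qed.
Let fcM X Y Z (g : hom C Y Z) (f : hom C X Y) :
  fc X Z (comp g f) = comp (fc Y Z g) (fc X Y f).
Proof. by rewrite /= !fmapM. Qed.
Definition functor_comp : linfunctor C E := LinFunctor fc1 fcM.
End FunctorComp.

Definition is_iso (C : lincat k) (X Y : C) (f : hom C X Y) : Prop :=
  exists g : hom C Y X, comp g f = idm X /\ comp f g = idm Y.

Definition naturally_iso (C D : lincat k) (F G : linfunctor C D) : Prop :=
  exists2 eta : forall X : C, hom D (F X) (G X),
    forall X, is_iso (eta X) &
    forall (X Y : C) (f : hom C X Y),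
      comp (eta Y) (fmap F f) = comp (fmap G f) (eta X).

Definition equivalent_lincat (C D : lincat k) : Prop :=
  exists (F : linfunctor C D) (G : linfunctor D C),
    naturally_iso (functor_comp G F) (functor_id C) /\
    naturally_iso (functor_comp F G) (functor_id D).

End Equivalence.

Arguments fmap {k C D} _ {X Y}.

(* The [K]-category structure of an [R]-category whose morphisms are all
   annihilated by [t]. *)
Section ResidueCategory.
Variables (R : idomainType) (t : R) (K : fieldType) (red : residue_map t K).

Definition annihilates (C : lincat R) : Prop :=
  forall (X Y : C) (f : hom C X Y), t *: f = 0.

Variables (C : lincat R) (tC : annihilates C).

Let rhom (X Y : C) : lmodType K := resmod red (tC (X := X) (Y := Y)).
Let rid X : rhom X X := idm X.
Let rcomp X Y Z (g : rhom Y Z) (f : rhom X Y) : rhom X Z :=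
  comp (g : hom C Y Z) (f : hom C X Y).
Let rlinl X Y Z (f : rhom X Y) : linear (fun g : rhom Y Z => rcomp g f).
Proof. by move=> a g h; apply: (comp_linl (f : hom C X Y) (rlift red a)). Qed.
Let rlinr X Y Z (g : rhom Y Z) : linear (fun f : rhom X Y => rcomp g f).
Proof. by move=> a f h; apply: (comp_linr (g : hom C Y Z) (rlift red a)). Qed.
Definition residue_cat : lincat K :=
  @LinCat K C rhom rid rcomp rlinl rlinr
    (@compA R C) (@comp1m R C) (@compm1 R C).

End ResidueCategory.

Section AdditiveHull.
Variables (k : nzRingType) (C : lincat k).

Record formal_sum := FormalSum {
  fs_size : nat;
  fs_obj :> 'I_fs_size -> C }.

(* The entry at [i], [j] is the component from the [i]-th summand of the source
   to the [j]-th summand of the target. *)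
Definition mxhom (X Y : formal_sum) : lmodType k :=
  dsum (fun i : 'I_(fs_size X) =>
    dsum (fun j : 'I_(fs_size Y) => hom C (X i) (Y j))).

Definition entry (X Y : formal_sum) (f : mxhom X Y) i j : hom C (X i) (Y j) :=
  f i j.

Lemma mxhomP X Y (f g : mxhom X Y) :
  (forall i j, entry f i j = entry g i j) -> f = g.
Proof. by move=> e; apply: dsumP => i; apply: dsumP => j; apply: e. Qed.

Definition mxid (X : formal_sum) : mxhom X X := fun i j =>
  match i =P j with
  | ReflectT e => ecast j (hom C (X i) (X j)) e (idm (X i))
  | ReflectF _ => 0
  end.
Arguments mxid : clear implicits.

Definition mxcomp (X Y Z : formal_sum) (g : mxhom Y Z) (f : mxhom X Y) :
    mxhom X Z :=
  fun i l => \sum_(j < fs_size Y) comp (entry g j l) (entry f i j).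

Let compl0 (X Y Z : C) (f : hom C X Y) : comp (0 : hom C Y Z) f = 0.
Proof. exact: (linear0 (mk_linear (@comp_linl k C X Y Z f))). Qed.
Let compr0 (X Y Z : C) (g : hom C Y Z) : comp g (0 : hom C X Y) = 0.
Proof. exact: (linear0 (mk_linear (@comp_linr k C X Y Z g))). Qed.

Let mxlinl X Y Z (f : mxhom X Y) : linear (fun g : mxhom Y Z => mxcomp g f).
Proof.
move=> a g h; apply: mxhomP => i l.
rewrite [RHS](_ : _ = a *: entry (mxcomp g f) i l + entry (mxcomp h f) i l)//.
rewrite /entry /mxcomp scaler_sumr -big_split /=.
by apply: eq_bigr => j _; rewrite -comp_linl.
Qed.
Let mxlinr X Y Z (g : mxhom Y Z) : linear (fun f : mxhom X Y => mxcomp g f).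
Proof.
move=> a f h; apply: mxhomP => i l.
rewrite [RHS](_ : _ = a *: entry (mxcomp g f) i l + entry (mxcomp g h) i l)//.
rewrite /entry /mxcomp scaler_sumr -big_split /=.
by apply: eq_bigr => j _; rewrite -comp_linr.
Qed.
Let mxcompA X Y Z W (h : mxhom Z W) (g : mxhom Y Z) (f : mxhom X Y) :
  mxcomp h (mxcomp g f) = mxcomp (mxcomp h g) f.
Proof.
apply: mxhomP => i l.
transitivity (\sum_(j < fs_size Z) \sum_(j' < fs_size Y)
    comp (entry h j l) (comp (entry g j' j) (entry f i j'))).
  apply: eq_bigr => j _.
  exact: (linear_sum (mk_linear (@comp_linr k C (X i) _ _ (entry h j l)))).
rewrite exchange_big /=; apply: eq_bigr => j _.
rewrite [RHS](linear_sum (mk_linear (@comp_linl k C _ (Y j) (W l) (entry f i j)))).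
by apply: eq_bigr => j' _; apply: compA.
Qed.
Let mxid_diag X i : entry (mxid X) i i = idm (X i).
Proof. by rewrite /entry /mxid; case: eqP => // e; rewrite eq_axiomK. Qed.
Let mxid_off X i j : i != j -> entry (mxid X) i j = 0.
Proof. by rewrite /entry /mxid; case: eqP. Qed.
Let mxcomp1m X Y (f : mxhom X Y) : mxcomp (mxid Y) f = f.
Proof.
apply: mxhomP => i j; rewrite /entry /mxcomp (bigD1 j) //= mxid_diag comp1m.
by rewrite big1 ?addr0 // => l lj; rewrite mxid_off // compl0.
Qed.
Let mxcompm1 X Y (f : mxhom X Y) : mxcomp f (mxid X) = f.
Proof.
apply: mxhomP => i j; rewrite /entry /mxcomp (bigD1 i) //= mxid_diag compm1.
by rewrite big1 ?addr0 // => l li; rewrite mxid_off 1?eq_sym // compr0.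
Qed.

Definition additive_hull : lincat k :=
  @LinCat k formal_sum mxhom mxid mxcomp mxlinl mxlinr mxcompA mxcomp1m mxcompm1.

End AdditiveHull.

Section Circle.
Variable RR : realType.

Definition tau : RR := 2 * pi.
Lemma tau_gt0 : 0 < tau. Proof. by rewrite mulr_gt0 // pi_gt0. Qed.
Lemma tau_neq0 : tau != 0. Proof. by rewrite gt_eqF // tau_gt0. Qed.

Definition tauZ : {pred RR} := [pred x | x / tau \is a Num.int].
Let tauZ_closed : zmod_closed tauZ.
Proof.
split=> [|x y]; rewrite !inE ?mul0r ?rpred0 // mulrBl.
exact: rpredB.
Qed.
HB.instance Definition _ := GRing.isZmodClosed.Build RR tauZ tauZ_closed.

Definition circle : Type := Quotient.quot tauZ.
HB.instance Definition _ := GRing.Zmodule.on circle.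

Definition cls (x : RR) : circle := \pi_(Quotient.quot tauZ) x.

Lemma clsD x y : cls (x + y) = cls x + cls y.
Proof. by rewrite /cls raddfD. Qed.
Lemma clsB x y : cls (x - y) = cls x - cls y.
Proof. by rewrite /cls raddfB. Qed.
Lemma cls0 : cls 0 = 0.
Proof. by rewrite /cls raddf0. Qed.
Lemma clsP x y : cls x = cls y <-> exists n : int, x = y + tau * n%:~R.
Proof.
have -> : (cls x = cls y) <-> (x - y \in tauZ).
  by rewrite Quotient.idealrBE; split => [e|/eqP//]; apply/eqP.
rewrite inE; split => [/intrP[n e]|[n ->]].
  by exists n; rewrite -e; field; rewrite tau_neq0.
rewrite (_ : _ / _ = n%:~R) ?intr_int //.
by field; rewrite tau_neq0.
Qed.
Lemma cls_surj (p : circle) : exists x, cls x = p.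
Proof. by exists (repr (p : Quotient.quot tauZ)); apply: reprK. Qed.

(* The representative of a class in [0, 2 pi). *)
Definition ang (p : circle) : RR :=
  let x := repr (p : Quotient.quot tauZ) in x - tau * (Num.floor (x / tau))%:~R.

Lemma angK p : cls (ang p) = p.
Proof.
rewrite -[RHS](reprK (p : Quotient.quot tauZ)); apply/clsP.
by exists (- Num.floor (repr (p : Quotient.quot tauZ) / tau)); rewrite /ang; ring.
Qed.
Lemma ang_itv p : 0 <= ang p < tau.
Proof.
rewrite /ang; set x := repr _; have t0 := tau_gt0.
have e : x = tau * (x / tau) by field; rewrite tau_neq0.
have l : (Num.floor (x / tau))%:~R <= x / tau := floor_le _.
have u : x / tau < (Num.floor (x / tau))%:~R + 1 by rewrite -intrD1 floorD1_gt.
rewrite {1 3}e; apply/andP; split; nra.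
Qed.

(* Turning by [a >= 0] in the negative direction leads from [p] to [q]. *)
Definition arrow (p q : circle) (a : RR) : bool := (0 <= a) && (q == p - cls a).

End Circle.

Section Representations.
Variables (RR : realType) (R : comNzRingType) (t : R).
Local Notation S1 := (circle RR).
Local Notation tau := (tau RR).

(* [rep_map V h : V[p] -> V[q]] is the structure map [V^(x, a)] for [p = [x]]
   and [h : arrow p q a], that is [0 <= a] and [q = [x - a]]; naming the target
   [q] avoids transports along equalities of points. *)
Record rep := Rep {
  rep_mod :> S1 -> lmodType R;
  rep_map : forall (p q : S1) (a : RR),
    arrow p q a -> {linear rep_mod p -> rep_mod q};
  rep_mapM : forall (p q r : S1) (a b : RR)
    (h : arrow p q b) (h' : arrow q r a) (h'' : arrow p r (a + b)) v,
    rep_map h' (rep_map h v) = rep_map h'' v;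
  rep_mapX : forall (p : S1) (n : nat) (h : arrow p p (tau * n%:R)) v,
    rep_map h v = t ^+ n *: v }.
Arguments rep_map _ {p q a} _.

Record rep_hom (V W : rep) := RepHom {
  rh_fun :> forall p, {linear V p -> W p};
  rh_nat : forall p q a (h : arrow p q a) v,
    rep_map W h (rh_fun p v) = rh_fun q (rep_map V h v) }.

Section HomModule.
Variables V W : rep.
Implicit Types f g : rep_hom V W.

Lemma rep_homP f g : (forall p v, f p v = g p v) -> f = g.
Proof.
case: f g => [f fN] [g gN] /= e.
have ? : f = g.
  by apply: functional_extensionality_dep => p; apply: linear_eq => v; apply: e.
by subst g; congr RepHom; apply: Prop_irrelevance.
Qed.

HB.instance Definition _ := gen_eqMixin (rep_hom V W).
HB.instance Definition _ := gen_choiceMixin (rep_hom V W).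

Definition rh_make (f : forall p, V p -> W p) (fL : forall p, linear (f p))
    (fN : forall p q a (h : arrow p q a) v,
      rep_map W h (f p v) = f q (rep_map V h v)) : rep_hom V W :=
  @RepHom V W (fun p => mk_linear (fL p)) fN.

Let zeroL p : linear (fun v : V p => 0 : W p).
Proof. by move=> a u v; rewrite scaler0 addr0. Qed.
Let zeroN p q a (h : arrow p q a) (v : V p) : rep_map W h 0 = 0.
Proof. exact: linear0. Qed.
Let oppL f p : linear (fun v => - f p v).
Proof. by move=> a u v; rewrite linearP opprD scalerN. Qed.
Let oppN f p q a (h : arrow p q a) v :
  rep_map W h (- f p v) = - f q (rep_map V h v).
Proof. by rewrite linearN rh_nat. Qed.
Let addL f g p : linear (fun v => f p v + g p v).
Proof. by move=> a u v; rewrite !linearP scalerDr addrACA. Qed.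
Let addN f g p q a (h : arrow p q a) v :
  rep_map W h (f p v + g p v) = f q (rep_map V h v) + g q (rep_map V h v).
Proof. by rewrite linearD !rh_nat. Qed.
Let scaleL (c : R) f p : linear (fun v => c *: f p v).
Proof. by move=> a u v; rewrite linearP scalerDr !scalerA mulrC. Qed.
Let scaleN (c : R) f p q a (h : arrow p q a) v :
  rep_map W h (c *: f p v) = c *: f q (rep_map V h v).
Proof. by rewrite linearZ /= rh_nat. Qed.

Let zero : rep_hom V W := rh_make zeroL zeroN.
Let opp f : rep_hom V W := rh_make (oppL f) (oppN f).
Let add f g : rep_hom V W := rh_make (addL f g) (addN f g).
Let scale (c : R) f : rep_hom V W := rh_make (scaleL c f) (scaleN c f).

Let addA : associative add.
Proof. by move=> f g h; apply: rep_homP => p v; apply: addrA. Qed.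
Let addC : commutative add.
Proof. by move=> f g; apply: rep_homP => p v; apply: addrC. Qed.
Let add0 : left_id zero add.
Proof. by move=> f; apply: rep_homP => p v; apply: add0r. Qed.
Let addNf : left_inverse zero opp add.
Proof. by move=> f; apply: rep_homP => p v; apply: addNr. Qed.
HB.instance Definition _ := GRing.isZmodule.Build (rep_hom V W)
  addA addC add0 addNf.

Let scaleA a b f : scale a (scale b f) = scale (a * b) f.
Proof. by apply: rep_homP => p v; apply: scalerA. Qed.
Let scale1 : left_id 1 scale.
Proof. by move=> f; apply: rep_homP => p v; apply: scale1r. Qed.
Let scaleDr : right_distributive scale +%R.
Proof. by move=> a f g; apply: rep_homP => p v; apply: scalerDr. Qed.
Let scaleDl f : {morph scale^~ f : a b / a + b}.
Proof. by move=> a b; apply: rep_homP => p v; apply: scalerDl. Qed.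
HB.instance Definition _ := GRing.Zmodule_isLmodule.Build R (rep_hom V W)
  scaleA scale1 scaleDr scaleDl.

Lemma rh_0E p v : (0 : rep_hom V W) p v = 0. Proof. by []. Qed.
Lemma rh_DE f g p v : (f + g) p v = f p v + g p v. Proof. by []. Qed.
Lemma rh_ZE a f p v : (a *: f) p v = a *: f p v. Proof. by []. Qed.

End HomModule.

Definition rh_id (V : rep) : rep_hom V V :=
  @RepHom V V (fun p => idfun) (fun _ _ _ _ _ => erefl).

Section HomComp.
Variables (U V W : rep) (g : rep_hom V W) (f : rep_hom U V).
Let compN p q a (h : arrow p q a) v :
  rep_map W h (g p (f p v)) = g q (f q (rep_map U h v)).
Proof. by rewrite !rh_nat. Qed.
Definition rh_comp : rep_hom U W := @RepHom U W (fun p => g p \o f p) compN.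
Lemma rh_compE p v : rh_comp p v = g p (f p v). Proof. by []. Qed.
End HomComp.

Definition rh_mono (V W : rep) (f : rep_hom V W) : Prop :=
  forall p, injective (f p).
Definition rh_epi (V W : rep) (f : rep_hom V W) : Prop :=
  forall p w, exists v, f p v = w.
Definition rh_exact (U V W : rep) (f : rep_hom U V) (g : rep_hom V W) : Prop :=
  forall p v, g p v = 0 <-> exists u, f p u = v.

Definition projective (V : rep) : Prop :=
  forall (W U : rep) (g : rep_hom W U) (f : rep_hom V U), rh_epi g ->
    exists h : rep_hom V W, rh_comp g h = f.

Section DirectSum.
Variables (I : finType) (V : I -> rep).
Let m p : lmodType R := dsum (fun i => V i p).
Let smap p q a (h : arrow p q a) : m p -> m q := fun v i => rep_map (V i) h (v i).
Let smapL p q a (h : arrow p q a) : linear (smap h).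
Proof. by move=> c u v; apply: dsumP => i; rewrite [LHS]linearP. Qed.
Let smapM (p q r : S1) (a b : RR)
  (h : arrow p q b) (h' : arrow q r a) (h'' : arrow p r (a + b)) v :
  smap h' (smap h v) = smap h'' v.
Proof. by apply: dsumP => i; apply: rep_mapM. Qed.
Let smapX (p : S1) (n : nat) (h : arrow p p (tau * n%:R)) v : smap h v = t ^+ n *: v.
Proof. by apply: dsumP => i; apply: rep_mapX. Qed.
Definition rep_dsum : rep := @Rep m (fun p q a h => mk_linear (smapL h)) smapM smapX.
End DirectSum.

Section BinarySum.
Variables V W : rep.
Let m p : lmodType R := (V p * W p)%type.
Let smap p q a (h : arrow p q a) : m p -> m q :=
  fun v => (rep_map V h v.1, rep_map W h v.2).
Let smapL p q a (h : arrow p q a) : linear (smap h).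
Proof. by move=> c [u u'] [v v']; rewrite /smap /= !linearP. Qed.
Let smapM (p q r : S1) (a b : RR)
  (h : arrow p q b) (h' : arrow q r a) (h'' : arrow p r (a + b)) v :
  smap h' (smap h v) = smap h'' v.
Proof. by case: v => v w; congr pair; apply: rep_mapM. Qed.
Let smapX (p : S1) (n : nat) (h : arrow p p (tau * n%:R)) v : smap h v = t ^+ n *: v.
Proof. by case: v => v w; congr pair; apply: rep_mapX. Qed.
Definition rep_sum : rep := @Rep m (fun p q a h => mk_linear (smapL h)) smapM smapX.

Let inlL p : linear (fun v : V p => (v, 0) : rep_sum p).
Proof.
move=> c u v; rewrite [RHS](_ : _ = (c *: u + v, c *: 0 + 0)) //.
by rewrite scaler0 addr0.
Qed.
Let inlN p q a (h : arrow p q a) (v : V p) :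
  rep_map rep_sum h (v, 0) = (rep_map V h v, 0).
Proof. by congr pair; apply: linear0. Qed.
Definition rh_inl : rep_hom V rep_sum := rh_make inlL inlN.

Let inrL p : linear (fun v : W p => (0, v) : rep_sum p).
Proof.
move=> c u v; rewrite [RHS](_ : _ = (c *: 0 + 0, c *: u + v)) //.
by rewrite scaler0 addr0.
Qed.
Let inrN p q a (h : arrow p q a) (v : W p) :
  rep_map rep_sum h (0, v) = (0, rep_map W h v).
Proof. by congr pair; apply: linear0. Qed.
Definition rh_inr : rep_hom W rep_sum := rh_make inrL inrN.

Let fstL p : linear (fun v : rep_sum p => v.1). Proof. by []. Qed.
Definition rh_fst : rep_hom rep_sum V :=
  rh_make fstL (fun _ _ _ _ _ => erefl).
Let sndL p : linear (fun v : rep_sum p => v.2). Proof. by []. Qed.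
Definition rh_snd : rep_hom rep_sum W :=
  rh_make sndL (fun _ _ _ _ _ => erefl).

Lemma projective_sum : projective V -> projective W -> projective rep_sum.
Proof.
move=> Vp Wp U T g f ge.
have [h hE] := Vp _ _ g (rh_comp f rh_inl) ge.
have [k kE] := Wp _ _ g (rh_comp f rh_inr) ge.
exists (rh_comp h rh_fst + rh_comp k rh_snd); apply: rep_homP => p [v w].
rewrite /= linearD /=.
have -> : g p (h p v) = f p (v, 0) by rewrite -[LHS]/(rh_comp g h p v) hE.
have -> : g p (k p w) = f p (0, w) by rewrite -[LHS]/(rh_comp g k p w) kE.
by rewrite -linearD; congr (f p _); congr pair; rewrite ?addr0 ?add0r.
Qed.

End BinarySum.

(* For [p = [x]] and [q = [x - alpha]], [0 <= alpha < 2 pi], the exponent [n]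
   such that [e_x^(alpha + b) = t ^ n e_x^gamma] with [0 <= gamma < 2 pi]. *)
Definition wind (p q : S1) (b : RR) : nat :=
  Num.truncn ((ang (p - q) + b) / tau).

Lemma windE (p q r : S1) b : arrow q r b ->
  ang (p - q) + b = ang (p - r) + tau * (wind p q b)%:R.
Proof.
case/andP => b0 /eqP rE; set a := ang (p - q).
have /andP[a0 at_] := ang_itv (p - q); have /andP[c0 ct] := ang_itv (p - r).
have t0 := tau_gt0 RR; have tn := tau_neq0 RR.
have /clsP[n nE] : cls (a + b) = cls (ang (p - r)).
  by rewrite clsD !angK rE opprD opprK addrA.
have nE' : (a + b) / tau = ang (p - r) / tau + n%:~R by rewrite nE; field.
have h : 0 <= ang (p - r) / tau < 1.
  by rewrite divr_ge0 ?(ltW t0) //= ltr_pdivrMr // mul1r.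
have fE : Num.floor ((a + b) / tau) = n.
  apply: floor_def; rewrite nE' intrD; case/andP: h => h1 h2.
  by apply/andP; split; lra.
have ge0 : 0 <= (a + b) / tau.
  by apply: divr_ge0; [apply: addr_ge0 | apply: ltW].
have n0 : 0 <= n by rewrite -fE floor_ge0.
rewrite nE /wind -/a truncn_floor fE ge0.
by case: n n0 {nE nE' fE}.
Qed.

(* Every [P_[x] [q]] is the free module [R^o] on the generator [1], which is
   [e_x^alpha] for [alpha = ang (p - q)]. *)
Section P.
Variable p : S1.
Let smap q r b (h : arrow q r b) : R^o -> R^o := fun v => t ^+ wind p q b * v.
Let smapL q r b (h : arrow q r b) : linear (smap h).
Proof.
move=> c u v; rewrite /smap (mulrDr (t ^+ _ : R)); congr (_ + _).
exact: (mulrCA (t ^+ _ : R)).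
Qed.
Let smapM (q r s : S1) (a b : RR)
  (h : arrow q r b) (h' : arrow r s a) (h'' : arrow q s (a + b)) v :
  smap h' (smap h v) = smap h'' v.
Proof.
rewrite /smap mulrA -exprD; congr (_ ^+ _ * _).
apply/eqP; rewrite -(@eqr_nat RR) natrD; apply/eqP.
apply: (mulfI (tau_neq0 RR)).
have := windE p h; have := windE p h'; have := windE p h''; lra.
Qed.
Let smapX (q : S1) (n : nat) (h : arrow q q (tau * n%:R)) v :
  smap h v = t ^+ n *: v.
Proof.
rewrite /smap; congr (_ ^+ _ * _).
apply/eqP; rewrite -(@eqr_nat RR); apply/eqP; apply: (mulfI (tau_neq0 RR)).
by have := windE p h; lra.
Qed.
Definition P_ : rep := @Rep (fun=> R^o) (fun q r b h => mk_linear (smapL h)) smapM smapX.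
End P.

Definition fin_gen (V : rep) : Prop :=
  exists (I : finType) (x : I -> S1) (g : rep_hom (rep_dsum (fun i => P_ (x i))) V),
    rh_epi g.

Lemma fin_gen_sum V W : fin_gen V -> fin_gen W -> fin_gen (rep_sum V W).
Proof.
case=> I [x [f fe]] [J [y [g ge]]].
pose z (k : I + J) := match k with inl i => x i | inr j => y j end.
exists (I + J)%type, z.
pose pf : rep_hom (rep_dsum (fun k => P_ (z k)))
                  (rep_dsum (fun k => P_ (x k))) :=
  @rh_make (rep_dsum (fun k => P_ (z k))) (rep_dsum (fun k => P_ (x k)))
    (fun p v k => v (inl k)) (fun _ _ _ _ => erefl) (fun _ _ _ _ _ => erefl).
pose pg : rep_hom (rep_dsum (fun k => P_ (z k)))
                  (rep_dsum (fun k => P_ (y k))) :=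
  @rh_make (rep_dsum (fun k => P_ (z k))) (rep_dsum (fun k => P_ (y k)))
    (fun p v k => v (inr k)) (fun _ _ _ _ => erefl) (fun _ _ _ _ _ => erefl).
exists (rh_comp (rh_inl V W) (rh_comp f pf) + rh_comp (rh_inr V W) (rh_comp g pg)).
move=> p [v w]; have [u uE] := fe p v; have [u' uE'] := ge p w.
exists (fun k => match k with inl i => u i | inr j => u' j end).
by rewrite rh_DE /= -uE -uE'; congr pair; rewrite ?addr0 ?add0r.
Qed.

End Representations.

Arguments rep_map {RR R t} _ {p q a} _.

Section Frobenius.
Variables (RR : realType) (R : comNzRingType) (t : R).
Local Notation rep := (rep RR t).

Record frob := Frob {
  fr_rep :> rep;
  fr_fg : fin_gen fr_rep;
  fr_proj : projective fr_rep;
  fr_d : rep_hom fr_rep fr_rep;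
  fr_dd : rh_comp fr_d fr_d = t *: rh_id fr_rep }.

Definition commutes (X Y : frob) : pred (rep_hom X Y) :=
  fun f => `[< rh_comp f (fr_d X) = rh_comp (fr_d Y) f >].

Record frob_hom (X Y : frob) := FrobHom {
  fh_rep :> rep_hom X Y;
  fh_comm : commutes fh_rep }.

Section FrobHomModule.
Variables X Y : frob.
HB.instance Definition _ := [isSub for @fh_rep X Y].
HB.instance Definition _ := [Choice of frob_hom X Y by <:].
Let commutes_closed : submod_closed (@commutes X Y).
Proof.
split=> [|a f g]; rewrite ?unfold_in /commutes.
  by apply/asboolP/rep_homP => p v; rewrite !rh_compE !rh_0E linear0.
move=> /asboolP fE /asboolP gE; apply/asboolP/rep_homP => p v.
have fE' : f p (fr_d X p v) = fr_d Y p (f p v).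
  by rewrite -[LHS]/(rh_comp f (fr_d X) p v) fE.
have gE' : g p (fr_d X p v) = fr_d Y p (g p v).
  by rewrite -[LHS]/(rh_comp g (fr_d X) p v) gE.
by rewrite !rh_compE !rh_DE !rh_ZE fE' gE' linearP.
Qed.
HB.instance Definition _ :=
  GRing.isSubmodClosed.Build R (rep_hom X Y) (@commutes X Y) commutes_closed.
HB.instance Definition _ := [SubChoice_isSubLmodule of frob_hom X Y by <:].
End FrobHomModule.

Lemma frob_homP X Y (f g : frob_hom X Y) : (forall p v, f p v = g p v) -> f = g.
Proof. by move=> e; apply: val_inj; apply: rep_homP. Qed.

Lemma frob_homC X Y (f : frob_hom X Y) p v : f p (fr_d X p v) = fr_d Y p (f p v).
Proof.
by have /asboolP e := fh_comm f; rewrite -[LHS]/(rh_comp f (fr_d X) p v) e.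
Qed.

Definition fh_make (X Y : frob) (f : rep_hom X Y)
    (fC : forall p v, f p (fr_d X p v) = fr_d Y p (f p v)) : frob_hom X Y :=
  FrobHom (introT (asboolP _)
    (rep_homP (f := rh_comp f (fr_d X)) (g := rh_comp (fr_d Y) f) fC)).

Lemma fh_0E X Y p v : (0 : frob_hom X Y) p v = 0. Proof. by []. Qed.
Lemma fh_DE X Y (f g : frob_hom X Y) p v : (f + g) p v = f p v + g p v.
Proof. by []. Qed.
Lemma fh_BE X Y (f g : frob_hom X Y) p v : (f - g) p v = f p v - g p v.
Proof. by []. Qed.
Lemma fh_ZE X Y a (f : frob_hom X Y) p v : (a *: f) p v = a *: f p v.
Proof. by []. Qed.

Definition fh_id X : frob_hom X X := @fh_make X X (rh_id X) (fun _ _ => erefl).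

Section FrobHomComp.
Variables (X Y Z : frob) (g : frob_hom Y Z) (f : frob_hom X Y).
Let compC p v : rh_comp g f p (fr_d X p v) = fr_d Z p (rh_comp g f p v).
Proof. by rewrite !rh_compE !frob_homC. Qed.
Definition fh_comp : frob_hom X Z := fh_make compC.
Lemma fh_compE p v : fh_comp p v = g p (f p v). Proof. by []. Qed.
End FrobHomComp.

(* Exactness of [0 -> X -> Y -> Z -> 0]. *)
Definition frob_exact (X Y Z : frob) (f : frob_hom X Y) (g : frob_hom Y Z) : Prop :=
  [/\ rh_mono f, rh_exact f g & rh_epi g].

Definition frob_projective (P : frob) : Prop :=
  forall (X Y Z : frob) (f : frob_hom X Y) (g : frob_hom Y Z) (h : frob_hom P Z),
    frob_exact f g -> exists k : frob_hom P Y, fh_comp g k = h.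

Definition frob_injective (I : frob) : Prop :=
  forall (X Y Z : frob) (f : frob_hom X Y) (g : frob_hom Y Z) (h : frob_hom X I),
    frob_exact f g -> exists k : frob_hom Y I, fh_comp k f = h.

Definition stably_zero (X Y : frob) : pred (frob_hom X Y) := fun f =>
  `[< exists (P : frob) (u : frob_hom X P) (v : frob_hom P Y),
        [/\ frob_projective P, frob_injective P & f = fh_comp v u] >].

Section FrobSum.
Variables X Y : frob.
Let d : rep_hom (rep_sum X Y) (rep_sum X Y) :=
  rh_comp (rh_inl X Y) (rh_comp (fr_d X) (rh_fst X Y)) +
  rh_comp (rh_inr X Y) (rh_comp (fr_d Y) (rh_snd X Y)).
Let dE p v : d p v = (fr_d X p v.1, fr_d Y p v.2).
Proof. by rewrite /d rh_DE; congr pair; rewrite ?addr0 ?add0r. Qed.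
Let dd : rh_comp d d = t *: rh_id (rep_sum X Y).
Proof.
apply: rep_homP => p [v w]; rewrite /= !dE /=.
congr pair; first by rewrite -[LHS]/(rh_comp (fr_d X) (fr_d X) p v) fr_dd.
by rewrite -[LHS]/(rh_comp (fr_d Y) (fr_d Y) p w) fr_dd.
Qed.
Definition frob_sum : frob := Frob (fin_gen_sum (fr_fg X) (fr_fg Y))
  (projective_sum (@fr_proj X) (@fr_proj Y)) dd.

Let inlC p v : rh_inl X Y p (fr_d X p v) = fr_d frob_sum p (rh_inl X Y p v).
Proof. by rewrite [RHS]dE; congr pair; rewrite linear0. Qed.
Definition fh_inl : frob_hom X frob_sum :=
  @fh_make X frob_sum (rh_inl X Y) inlC.
Let inrC p v : rh_inr X Y p (fr_d Y p v) = fr_d frob_sum p (rh_inr X Y p v).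
Proof. by rewrite [RHS]dE; congr pair; rewrite linear0. Qed.
Definition fh_inr : frob_hom Y frob_sum :=
  @fh_make Y frob_sum (rh_inr X Y) inrC.
Let fstC p v : rh_fst X Y p (fr_d frob_sum p v) = fr_d X p (rh_fst X Y p v).
Proof. by rewrite [fr_d frob_sum p v]dE. Qed.
Definition fh_fst : frob_hom frob_sum X :=
  @fh_make frob_sum X (rh_fst X Y) fstC.
Let sndC p v : rh_snd X Y p (fr_d frob_sum p v) = fr_d Y p (rh_snd X Y p v).
Proof. by rewrite [fr_d frob_sum p v]dE. Qed.
Definition fh_snd : frob_hom frob_sum Y :=
  @fh_make frob_sum Y (rh_snd X Y) sndC.

Lemma frob_sum_projective :
  frob_projective X -> frob_projective Y -> frob_projective frob_sum.
Proof.
move=> XP YP A B C f g h fg.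
have [k kE] := XP _ _ _ f g (fh_comp h fh_inl) fg.
have [l lE] := YP _ _ _ f g (fh_comp h fh_inr) fg.
exists (fh_comp k fh_fst + fh_comp l fh_snd); apply: frob_homP => p [v w].
rewrite fh_compE fh_DE !fh_compE linearD.
have -> : g p (k p v) = h p (v, 0) by rewrite -[LHS]/(fh_comp g k p v) kE.
have -> : g p (l p w) = h p (0, w) by rewrite -[LHS]/(fh_comp g l p w) lE.
by rewrite -linearD; congr (h p _); congr pair; rewrite ?addr0 ?add0r.
Qed.

Lemma frob_sum_injective :
  frob_injective X -> frob_injective Y -> frob_injective frob_sum.
Proof.
move=> XI YI A B C f g h fg.
have [k kE] := XI _ _ _ f g (fh_comp fh_fst h) fg.
have [l lE] := YI _ _ _ f g (fh_comp fh_snd h) fg.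
exists (fh_comp fh_inl k + fh_comp fh_inr l); apply: frob_homP => p v.
rewrite fh_compE fh_DE !fh_compE.
have -> : k p (f p v) = (h p v).1 by rewrite -[LHS]/(fh_comp k f p v) kE.
have -> : l p (f p v) = (h p v).2 by rewrite -[LHS]/(fh_comp l f p v) lE.
by case: (h p v) => a b; congr pair; rewrite ?addr0 ?add0r.
Qed.

End FrobSum.

Section FrobZero.
Let x (i : void) : circle RR := match i with end.
Let V : rep := rep_dsum (fun i => P_ t (x i)).
Let V0 p (v w : V p) : v = w. Proof. by apply: dsumP; case. Qed.
Let Vfg : fin_gen V.
Proof.
by exists void, x, (rh_id V) => p v; exists v.
Qed.
Let Vp : projective V.
Proof.
move=> W U g f _; exists 0; apply: rep_homP => p v.
by rewrite ?fh_compE ?rh_compE (V0 v 0) !linear0.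
Qed.
Let dd : rh_comp (0 : rep_hom V V) 0 = t *: rh_id V.
Proof. by apply: rep_homP => p v; apply: V0. Qed.
Definition frob_zero : frob := Frob Vfg Vp dd.

Lemma frob_zero_projective : frob_projective frob_zero.
Proof.
move=> X Y Z f g h _; exists 0; apply: frob_homP => p v.
by rewrite ?fh_compE ?rh_compE (V0 v 0) !linear0.
Qed.
Lemma frob_zero_injective : frob_injective frob_zero.
Proof.
by move=> X Y Z f g h _; exists 0; apply: frob_homP => p v; apply: V0.
Qed.
End FrobZero.

Lemma stably_zero_closed X Y : submod_closed (@stably_zero X Y).
Proof.
split=> [|a f g]; rewrite ?unfold_in /stably_zero.
  apply/asboolP; exists frob_zero, 0, 0; split;
    [exact: frob_zero_projective | exact: frob_zero_injective |].
  by apply: frob_homP => p v; rewrite fh_compE !fh_0E ?linear0.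
move=> /asboolP[P [u [v [Pp Pi fE]]]] /asboolP[Q [u' [v' [Qp Qi gE]]]].
apply/asboolP; exists (frob_sum P Q), (fh_comp (fh_inl P Q) u + fh_comp (fh_inr P Q) u').
exists (a *: fh_comp v (fh_fst P Q) + fh_comp v' (fh_snd P Q)); split.
- exact: frob_sum_projective.
- exact: frob_sum_injective.
apply: frob_homP => p x; rewrite fE gE !(fh_compE, fh_DE, fh_ZE).
congr (_ *: v p _ + v' p _).
- by rewrite -[RHS]/(u p x + 0) addr0.
- by rewrite -[RHS]/(0 + u' p x) add0r.
Qed.

Lemma stably_zero_comp X Y Z W (h : frob_hom Z W) (g : frob_hom Y Z)
  (f : frob_hom X Y) : stably_zero g -> stably_zero (fh_comp h (fh_comp g f)).
Proof.
case/asboolP => P [u [v [Pp Pi ->]]]; apply/asboolP.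
by exists P, (fh_comp u f), (fh_comp h v); split => //; apply: frob_homP.
Qed.

Definition stable_hom (X Y : frob) : lmodType R :=
  quotmod (@stably_zero_closed X Y).

Definition stable_class (X Y : frob) (f : frob_hom X Y) : stable_hom X Y :=
  qpi (@stably_zero_closed X Y) f.

Definition stable_comp (X Y Z : frob) (g : stable_hom Y Z) (f : stable_hom X Y) :
    stable_hom X Z := stable_class (fh_comp (qrepr g) (qrepr f)).

Lemma stable_classP X Y (f g : frob_hom X Y) :
  stable_class f = stable_class g <-> stably_zero (f - g).
Proof. exact: qpiE. Qed.

Lemma stable_compE X Y Z (g : frob_hom Y Z) (f : frob_hom X Y) :
  stable_comp (stable_class g) (stable_class f) = stable_class (fh_comp g f).
Proof.
apply/stable_classP; set g' := qrepr _; set f' := qrepr _.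
have gz : stably_zero (g' - g) := qrepr_pi (@stably_zero_closed Y Z) g.
have fz : stably_zero (f' - f) := qrepr_pi (@stably_zero_closed X Y) f.
have -> : fh_comp g' f' - fh_comp g f =
   1 *: fh_comp (fh_id Z) (fh_comp (g' - g) f') +
   fh_comp g (fh_comp (f' - f) (fh_id X)).
  apply: frob_homP => p v; rewrite scale1r.
  rewrite -[RHS]/(g' p (f' p v) - g p (f' p v) + g p (f' p v - f p v)).
  by rewrite (linearB (g p)) addrA subrK.
by apply: (stably_zero_closed X Z).2; apply: stably_zero_comp.
Qed.

Lemma stable_ind X Y (P : stable_hom X Y -> Prop) :
  (forall f, P (stable_class f)) -> forall f, P f.
Proof. by move=> h f; rewrite -[f]qreprK; apply: h. Qed.

Lemma stable_class_lin X Y a (f g : frob_hom X Y) :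
  stable_class (a *: f + g) = a *: stable_class f + stable_class g.
Proof. by rewrite /stable_class qpiD qpiZ. Qed.

Let stable_id X : stable_hom X X := stable_class (fh_id X).
Let stable_linl X Y Z (f : stable_hom X Y) :
  linear (fun g : stable_hom Y Z => stable_comp g f).
Proof.
move=> a; elim/stable_ind: f => f; elim/stable_ind => g; elim/stable_ind => h.
rewrite -stable_class_lin !stable_compE -stable_class_lin.
by congr stable_class; apply: frob_homP.
Qed.
Let stable_linr X Y Z (g : stable_hom Y Z) :
  linear (fun f : stable_hom X Y => stable_comp g f).
Proof.
move=> a; elim/stable_ind: g => g; elim/stable_ind => f; elim/stable_ind => h.
rewrite -stable_class_lin !stable_compE -stable_class_lin.
by congr stable_class; apply: frob_homP => p v; rewrite !(fh_compE, fh_DE, fh_ZE) linearP.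
Qed.
Let stable_compA X Y Z W (h : stable_hom Z W) (g : stable_hom Y Z)
  (f : stable_hom X Y) :
  stable_comp h (stable_comp g f) = stable_comp (stable_comp h g) f.
Proof.
elim/stable_ind: f => f; elim/stable_ind: g => g; elim/stable_ind: h => h.
by rewrite !stable_compE; congr stable_class; apply: frob_homP.
Qed.
Let stable_comp1m X Y (f : stable_hom X Y) : stable_comp (stable_id Y) f = f.
Proof.
elim/stable_ind: f => f.
by rewrite stable_compE; congr stable_class; apply: frob_homP.
Qed.
Let stable_compm1 X Y (f : stable_hom X Y) : stable_comp f (stable_id X) = f.
Proof.
elim/stable_ind: f => f.
by rewrite stable_compE; congr stable_class; apply: frob_homP.
Qed.

Definition stable_cat : lincat R :=
  @LinCat R frob stable_hom stable_id stable_comp stable_linl stable_linr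
    stable_compA stable_comp1m stable_compm1.

End Frobenius.

Section Cluster.
Variables (RR : realType) (K : fieldType).
Local Notation tau := (tau RR).
Local Notation cls := (@cls RR).

Record ppair := PPair {
  pp0 : circle RR;
  pp1 : circle RR;
  pp_neq : pp0 != pp1 }.

(* [(x, y)] is a pair of real coordinates for [X]. *)
Definition label (X : ppair) (x y : RR) : Prop :=
  [/\ cls x = pp0 X, cls y = pp1 X & x < y < x + tau].

(* [gen false X Y] says that the generator [b_+^XY] exists, [gen true X Y] that
   [b_-^XY] does. *)
Definition gen (e : bool) (X Y : ppair) : Prop :=
  exists x0 x1 y0 y1, [/\ label X x0 x1, label Y y0 y1 &
    if e then [/\ x0 <= y1, y1 < x1, x1 <= y0 + tau & y0 + tau < x0 + tau]
    else [/\ x0 <= y0, y0 < x1, x1 <= y1 & y1 < x0 + tau]].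

Definition sgn (X Y : ppair) : bool := `[< gen true X Y >].

Definition dimC (X Y : ppair) : bool := `[< gen false X Y \/ gen true X Y >].

(* One-dimensional, with basis [const_mx 1] standing for the generator, if
   [dimC X Y] holds, and zero otherwise. *)
Definition indC_hom (X Y : ppair) : lmodType K := 'rV[K]_(dimC X Y).

Definition coef X Y (f : indC_hom X Y) : K := \sum_i f 0 i.

Definition indC_id (X : ppair) : indC_hom X X := const_mx 1.

Definition indC_comp X Y Z (g : indC_hom Y Z) (f : indC_hom X Y) :
    indC_hom X Z :=
  if sgn X Z == sgn X Y (+) sgn Y Z then const_mx (coef g * coef f) else 0.

Lemma tau_int (n : int) :
  [\/ n = 0, n = -1, tau <= tau * n%:~R | tau * n%:~R <= - tau - tau].
Proof.
have t0 := tau_gt0 RR; case: n => [[|n]|[|n]]; first by constructor 1.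
- constructor 3; rewrite -[leLHS]mulr1 ler_pM2l // -pmulrn ler1n //.
- by constructor 2.
constructor 4; rewrite NegzE mulrNz mulrN -opprD lerN2 -pmulrn.
by rewrite -mulr2n -mulr_natr ler_pM2l // ler_nat.
Qed.

Lemma label_shift X x y (n : int) :
  label X x y -> label X (x + tau * n%:~R) (y + tau * n%:~R).
Proof.
case=> xX yX /andP[h1 h2]; split; last by apply/andP; split; lra.
  by rewrite -xX; apply/clsP; exists n.
by rewrite -yX; apply/clsP; exists n.
Qed.

Lemma label_uniq X x y x' y' : label X x y -> label X x' y' ->
  exists n : int, x' = x + tau * n%:~R /\ y' = y + tau * n%:~R.
Proof.
have t0 := tau_gt0 RR; rewrite /label.
case=> <- <- /andP[h1 h2] [/clsP[n nE] /clsP[m mE] /andP[h3 h4]].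
exists n; split=> //; rewrite mE.
have e : tau * (m - n)%:~R = tau * m%:~R - tau * n%:~R by rewrite intrB mulrBr.
case: (tau_int (m - n)) => h; [|exfalso..].
- by move/eqP: h; rewrite subr_eq0 => /eqP ->.
- by rewrite h mulrN1z mulrN mulr1 in e; lra.
- by rewrite e in h; lra.
- by rewrite e in h; lra.
Qed.

Lemma label_ex X : exists x y, label X x y.
Proof.
have [x xE] := cls_surj (pp0 X).
exists x, (x + ang (pp1 X - pp0 X)).
have /andP[h1 h2] := ang_itv (pp1 X - pp0 X).
split=> //; first by rewrite clsD angK xE addrC subrK.
rewrite ltrDl ltrD2l h2 andbT lt_neqAle h1 andbT eq_sym.
apply: contraNN (pp_neq X) => /eqP e; rewrite eq_sym -subr_eq0.
by rewrite -[_ - _]angK e cls0.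
Qed.

Lemma pp_neq_sym X : pp1 X != pp0 X. Proof. by rewrite eq_sym pp_neq. Qed.

Definition pp_swap (X : ppair) : ppair := PPair (pp_neq_sym X).
Definition pp_twist (e : bool) (X : ppair) : ppair :=
  if e then pp_swap X else X.

Lemma pp_swapK : involutive pp_swap.
Proof. by case=> p q pq; congr PPair; apply: bool_irrelevance. Qed.

Lemma label_swap X x y : label X x y -> label (pp_swap X) y (x + tau).
Proof.
case=> xX yX /andP[h1 h2]; split=> //; last by apply/andP; split; lra.
by rewrite /= -xX; apply/clsP; exists 1; rewrite mulr1.
Qed.

Lemma gen_swap2 X Y : gen false X Y -> gen false (pp_swap X) (pp_swap Y).
Proof.
case=> x0 [x1 [y0 [y1 [lX lY [h1 h2 h3 h4]]]]].
exists x1, (x0 + tau), y1, (y0 + tau); split; [exact: label_swap..|].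
by split; lra.
Qed.

Lemma gen_swapr X Y : gen true X Y <-> gen false X (pp_swap Y).
Proof.
split=> -[x0 [x1 [y0 [y1 [lX lY [h1 h2 h3 h4]]]]]].
  by exists x0, x1, y1, (y0 + tau); split=> //; exact: label_swap.
exists x0, x1, (y1 - tau), y0; split=> //; last by split; lra.
have := label_shift (-1) (label_swap lY); rewrite pp_swapK mulrN1z mulrN mulr1.
by rewrite addrK.
Qed.

Lemma gen_twist e d X Y : gen e X Y <-> gen false (pp_twist d X) (pp_twist (d (+) e) Y).
Proof.
have h : gen e X Y <-> gen false X (pp_twist e Y) by case: e => //; exact: gen_swapr.
rewrite h; case: d => //=; case: e {h} => /=; split => /gen_swap2;
  by rewrite ?pp_swapK.
Qed.

Lemma gen_at X Y x0 x1 : label X x0 x1 -> gen false X Y ->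
  exists y0 y1, label Y y0 y1 /\ [/\ x0 <= y0, y0 < x1, x1 <= y1 & y1 < x0 + tau].
Proof.
move=> lX [x0' [x1' [y0 [y1 [lX' lY [h1 h2 h3 h4]]]]]].
have [n [e0 e1]] := label_uniq lX' lX.
exists (y0 + tau * n%:~R), (y1 + tau * n%:~R); split; first exact: label_shift.
by rewrite e0 e1; split; lra.
Qed.

Lemma gen_exclusive X Y : gen false X Y -> gen true X Y -> False.
Proof.
have [x0 [x1 lX]] := label_ex X; have t0 := tau_gt0 RR.
move=> /(gen_at lX)[y0 [y1 [lY [h1 h2 h3 h4]]]].
move=> /gen_swapr /(gen_at lX)[z1 [z0 [lY' [h5 h6 h7 h8]]]].
have [n [e1 e0]] := label_uniq (label_swap lY) lY'.
by case: (tau_int n) => h; subst; rewrite ?mulr0 ?mulrN1z ?mulrN ?mulr1 in h6 h7 h8 *; lra.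
Qed.

Lemma gen_assoc X Y Z W : gen false X Y -> gen false Y Z -> gen false Z W ->
  gen false X W -> (gen false X Z <-> gen false Y W).
Proof.
have [x0 [x1 lX]] := label_ex X; have t0 := tau_gt0 RR.
move=> /(gen_at lX)[y0 [y1 [lY [h1 h2 h3 h4]]]].
move=> /(gen_at lY)[z0 [z1 [lZ [h5 h6 h7 h8]]]].
move=> /(gen_at lZ)[w0 [w1 [lW [h9 h10 h11 h12]]]].
move=> /(gen_at lX)[w0' [w1' [lW' [h13 h14 h15 h16]]]].
have [n [e0 e1]] := label_uniq lW lW'.
have [nE|nE|nE|nE] := tau_int n.
- rewrite nE mulr0 !addr0 in e0 e1.
  split=> _.
    by exists y0, y1, w0, w1; split=> //; split; lra.
  by exists x0, x1, z0, z1; split=> //; split; lra.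
- rewrite nE mulrN1z mulrN mulr1 in e0 e1.
  split.
    move=> /(gen_at lX)[a0 [a1 [lZ' [k1 k2 k3 k4]]]]; exfalso.
    have [m [f0 f1]] := label_uniq lZ lZ'.
    by case: (tau_int m) => h; [move: h f0 f1 => -> .. | |];
      rewrite ?mulr0 ?mulrN1z ?mulrN ?mulr1; lra.
  move=> /(gen_at lY)[a0 [a1 [lW2 [k1 k2 k3 k4]]]]; exfalso.
  have [m [f0 f1]] := label_uniq lW lW2.
  by case: (tau_int m) => h; [move: h f0 f1 => -> .. | |];
    rewrite ?mulr0 ?mulrN1z ?mulrN ?mulr1; lra.
- by exfalso; lra.
- by exfalso; lra.
Qed.

Lemma sgnP e X Y : gen e X Y -> sgn X Y = e.
Proof.
case: e => h; first exact/asboolP.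
by apply/asboolP => h'; apply: gen_exclusive h h'.
Qed.

Lemma dimCP X Y : reflect (gen (sgn X Y) X Y) (dimC X Y).
Proof.
apply: (iffP (asboolP _)) => [[h|h]|]; rewrite ?(sgnP h) //.
by case: (sgn X Y); [right|left].
Qed.

Lemma dimC_gen X Y e : (dimC X Y && (sgn X Y == e)) = `[< gen e X Y >].
Proof.
apply/andP/asboolP => [[/dimCP h /eqP <-]//|h].
by split; [apply/dimCP; rewrite (sgnP h) | rewrite (sgnP h)].
Qed.

Lemma gen_id X : gen false X X.
Proof.
have [x [y l]] := label_ex X; have [_ _ /andP[h1 h2]] := l.
by exists x, y, x, y; split.
Qed.

Lemma coef_const X Y (a : K) :
  coef (const_mx a : indC_hom X Y) = if dimC X Y then a else 0.
Proof.
rewrite /coef; case: (dimC X Y); last by rewrite big_ord0.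
by rewrite big_ord1 mxE.
Qed.

Lemma coef_inj X Y : injective (@coef X Y).
Proof.
rewrite /coef /indC_hom; case: (dimC X Y) => f g.
  by rewrite !big_ord1 => e; apply/rowP => i; rewrite ord1.
by move=> _; apply/rowP => -[].
Qed.

Lemma coef0 X Y (f : indC_hom X Y) : ~~ dimC X Y -> coef f = 0.
Proof.
rewrite /coef; move: f; rewrite /indC_hom; case: (dimC X Y) => //= f _.
by rewrite big_ord0.
Qed.

Lemma coefP X Y a (f g : indC_hom X Y) : coef (a *: f + g) = a * coef f + coef g.
Proof.
rewrite /coef mulr_sumr -big_split /=.
by apply: eq_bigr => i _; rewrite !mxE.
Qed.

Lemma coef_comp X Y Z (g : indC_hom Y Z) (f : indC_hom X Y) :
  coef (indC_comp g f) =
    if `[< gen (sgn X Y (+) sgn Y Z) X Z >] then coef g * coef f else 0.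
Proof.
rewrite -dimC_gen /indC_comp; case: ifP => _; rewrite ?andbT ?andbF.
  exact: coef_const.
by rewrite /coef big1 // => i _; rewrite mxE.
Qed.

Let indC_linl X Y Z (f : indC_hom X Y) :
  linear (fun g : indC_hom Y Z => indC_comp g f).
Proof.
move=> a g h; apply: coef_inj; rewrite coefP !coef_comp coefP.
by case: ifP => _; ring.
Qed.
Let indC_linr X Y Z (g : indC_hom Y Z) :
  linear (fun f : indC_hom X Y => indC_comp g f).
Proof.
move=> a g' h; apply: coef_inj; rewrite coefP !coef_comp coefP.
by case: ifP => _; ring.
Qed.
Let indC_compA X Y Z W (h : indC_hom Z W) (g : indC_hom Y Z)
  (f : indC_hom X Y) :
  indC_comp h (indC_comp g f) = indC_comp (indC_comp h g) f.
Proof.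
apply: coef_inj; rewrite !coef_comp.
have [/dimCP d1|/(coef0 f) ->] := boolP (dimC X Y); last by rewrite !(mulr0, if_same).
have [/dimCP d2|/(coef0 g) ->] := boolP (dimC Y Z);
  last by rewrite !(mulr0, mul0r, if_same).
have [/dimCP d3|/(coef0 h) ->] := boolP (dimC Z W);
  last by rewrite !(mul0r, if_same).
move: d1 d2 d3; set a := sgn X Y; set b := sgn Y Z; set c := sgn Z W => d1 d2 d3.
have key : gen (a (+) b (+) c) X W -> (gen (a (+) b) X Z <-> gen (b (+) c) Y W).
  move: d1 d2 d3 => /(gen_twist _ false) d1 /(gen_twist _ a) d2.
  move=> /(gen_twist _ (a (+) b)) d3 /(gen_twist _ false) d4.
  rewrite (gen_twist (a (+) b) false) (gen_twist (b (+) c) a) (addbA a b c).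
  exact: gen_assoc d1 d2 d3 d4.
case: (asboolP (gen (a (+) b) X Z)) => [g1|n1].
  rewrite (sgnP g1); case: (asboolP (gen (a (+) b (+) c) X W)) => [g2|n2].
    have g3 := (key g2).1 g1.
    by rewrite (asboolT g3) (sgnP g3) addbA (asboolT g2) mulrA.
  case: (asboolP (gen (b (+) c) Y W)) => [g3|n3].
    by rewrite (sgnP g3) addbA (asboolF n2).
  by rewrite mul0r if_same.
rewrite mulr0 if_same.
case: (asboolP (gen (b (+) c) Y W)) => [g3|n3]; last by rewrite mul0r if_same.
rewrite (sgnP g3) addbA.
by case: asboolP => // g2; case: n1; apply: (key g2).2.
Qed.
Let indC_comp1m X Y (f : indC_hom X Y) : indC_comp (indC_id Y) f = f.
Proof.
apply: coef_inj; rewrite coef_comp coef_const (sgnP (gen_id Y)) addbF.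
rewrite -dimC_gen eqxx andbT.
have -> : dimC Y Y by apply/asboolP; left; apply: gen_id.
by case: ifPn => [_|/coef0 ->//]; rewrite mul1r.
Qed.
Let indC_compm1 X Y (f : indC_hom X Y) : indC_comp f (indC_id X) = f.
Proof.
apply: coef_inj; rewrite coef_comp coef_const (sgnP (gen_id X)) addFb.
rewrite -dimC_gen eqxx andbT.
have -> : dimC X X by apply/asboolP; left; apply: gen_id.
by case: ifPn => [_|/coef0 ->//]; rewrite mulr1.
Qed.

Definition indC : lincat K :=
  @LinCat K ppair indC_hom indC_id indC_comp indC_linl indC_linr
    indC_compA indC_comp1m indC_compm1.

Definition cluster_cat : lincat K := additive_hull indC.

End Cluster.

(* Main.v *)
Require Import Defs.
From HB Require Import structures.
From mathcomp Require Import all_boot all_order all_algebra.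
From mathcomp Require Import all_classical all_reals all_analysis.
From mathcomp Require Import ring lra.
(* Imported again so that [hom] denotes the morphisms of a linear category. *)
Require Import Defs.

Set Implicit Arguments.
Unset Strict Implicit.
Unset Printing Implicit Defensive.

(** A pair of points [X = (p, q)] is sent to the cell
    [P_p + P_q] with [d e_p = e_q ^ a] and [d e_q = e_p ^ (2 pi - a)], where [a]
    is the angle from [p] to [q]. This becomes an equivalence for the following
    reasons.

    The exact structure is split on underlying representations, so an object
    [W + W] with [d (a, b) = (t b, a)] is projective and injective, and every
    projective object is a retract of such a double. Hence a morphism is stably
    zero exactly when it is null-homotopic, that is of the form [h d + d h] with
    [h] a morphism of representations ([stably_zeroP]).

    A morphism of cells is the sum of a diagonal and an antidiagonal part. The
    diagonal part is a scalar times a shift, which moves the two points of the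
    source onto those of the target ([diag_shift]). An explicit homotopy kills the shift as soon
    as one of the points reaches the old position of the other; otherwise a
    multiple of it is null-homotopic only if the scalar is divisible by [t]
    ([shift_not_null]). The surviving shifts are the generators [b_+], and
    exchanging the two points of the target turns the antidiagonal part into
    the generators [b_-]. Shifts compose by adding distances, which is the
    composition rule of the cluster category ([generator_comp]).

    Every object [(V, d)] is a sum of cells ([cell_decomposition]). In the image
    of an idempotent [e <> 0] choose [v] at [p] and [w] at [q] such that [d v] is
    the image of [w], [w] has a unit coordinate, and the distance from [q] down
    to [p] is the smallest that occurs ([shortest_differential]). A coordinate
    function [phi] with [phi w = 1] and the lift of [phi d] along the shift from
    [q] to [p], which exists by minimality, give a map from [V] to the cell of
    [p] and [q]. On the copy of the cell spanned by [v] and [w] this map is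
    [1 + c d], and this is invertible because [(1 - c d) (1 + c d) = 1 - c ^ 2 t]
    is a unit of [R] ([split_cell]). Splitting off cells stops because their
    number is bounded by the rank of a free module containing [V]. Multiplication
    by [t] is null-homotopic on cells, hence zero in the stable category, and
    cells with [p = q] vanish there.

    What remains is formal: a fully faithful functor such that every object is a
    biproduct of objects in its image, and all such biproducts exist, extends to
    an equivalence from the additive hull ([equivalent_hull]). *)

Import Order.TTheory GRing.Theory Num.Theory.
Local Open Scope classical_set_scope.
Local Open Scope ring_scope.

(** * Discrete valuation rings *)

Section DiscreteValuationRing.
Variables (R : idomainType) (t : R).
Hypotheses (R_dvr : is_dvr R) (t_unif : uniformizer t).

Lemma principal_ideal (g : R) : is_ideal (principal g).
Proof.
split; first by exists 0; rewrite mul0r.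
by move=> a x y [b ->] [c ->]; exists (a * b + c); ring.
Qed.

Lemma maximal_prime (I : set R) : maximal_ideal I -> prime_ideal I.
Proof.
case=> -[I0 IP] I1 Imax; split=> // x y Ixy.
have [Ix|nIx] := pselect (I x); [by left | right].
pose J : set R := [set z | exists a b, I b /\ z = a * x + b].
have JI : is_ideal J.
  split; first by exists 0, 0; rewrite mul0r addr0.
  move=> c _ _ [a [b [Ib ->]]] [a' [b' [Ib' ->]]].
  by exists (c * a + a'), (c * b + b'); split; [apply: IP | ring].
have [|nJ1] := pselect (J 1).
  case=> a [b [Ib e]].
  have -> : y = a * (x * y) + y * b by rewrite -[LHS]mul1r e; ring.
  apply: (IP a (x * y)) => //; rewrite -[_ * _]addr0; apply: IP => //.
exfalso; apply: nIx; rewrite -(Imax J JI nJ1).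
  by exists 1, 0; rewrite mul1r addr0.
by move=> z Iz; exists 0, z; rewrite mul0r add0r.
Qed.

Lemma maximal_ideal_above (r : R) :
  ~ principal r 1 -> exists2 I, maximal_ideal I & I r.
Proof.
move=> r1.
(* The empty set is admitted because it is the union of the empty chain. *)
pose P (A : set R) := A = set0 \/ [/\ is_ideal A, ~ A 1 & A r].
have [|A [PA Amax]] := @Zorn_bigcup R P.
  move=> F FP Ftot.
  have [[X [FX Xr]]|nF] := pselect (exists X, F X /\ X r); last first.
    left; apply/seteqP; split => // x [X FX Xx].
    case: (FP _ FX) => [X0|[_ _ Xr]]; first by rewrite X0 in Xx.
    by case: nF; exists X.
  have FE Y y : F Y -> Y y -> [/\ is_ideal Y, ~ Y 1 & Y r].
    by move=> FY Yy; case: (FP _ FY) => // Y0; rewrite Y0 in Yy.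
  right; split.
  - split; first by exists X => //; case: (FE _ _ FX Xr) => -[].
    move=> a x y [Y FY Yx] [Z FZ Zy].
    have [[_ YP] _ _] := FE _ _ FY Yx; have [[_ ZP] _ _] := FE _ _ FZ Zy.
    have [YZ|ZY] := Ftot _ _ FY FZ.
      by exists Z => //; apply: ZP => //; apply: YZ.
    by exists Y => //; apply: YP => //; apply: ZY.
  - by case=> Y FY Y1; have [_ /(_ Y1)] := FE _ _ FY Y1.
  - by exists X.
have rP : P (principal r).
  by right; split=> //; [apply: principal_ideal | exists 1; rewrite mul1r].
case: PA => [A0|[AI A1 Ar]].
  case: (Amax (principal r)) => //; split; first by rewrite A0; apply: sub0set.
  rewrite A0 => /(_ r); apply; by exists 1; rewrite mul1r.
exists A => //; split=> // J JI J1 AJ; apply/seteqP; split => //.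
apply: contrapT => nJA; apply: (Amax J); first by split.
by right; split=> //; apply: AJ.
Qed.

Lemma uniformizer_neq0 : t != 0.
Proof.
apply/eqP => t0; case: R_dvr => _ [I [[Ip I0] _]]; case: t_unif => _ _ tmax.
have [II I1 _] := Ip; apply: I0; rewrite (tmax I II I1); last first.
  by move=> x [a ->]; rewrite t0 mulr0; case: II.
by apply/seteqP; split=> [x [a ->]|x ->]; [rewrite t0 mulr0|exists 0; rewrite mul0r].
Qed.

Lemma uniformizer_nunit : t \isn't a GRing.unit.
Proof.
by case: t_unif => _ t1 _; apply/negP => tU; apply: t1; exists t^-1; rewrite mulVr.
Qed.

(** A nonzero non-unit lies in a maximal ideal, which is a nonzero prime, and
    [(t)] is the only one. *)
Lemma nonunit_dvd (r : R) : r \isn't a GRing.unit -> exists a, r = a * t.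
Proof.
move=> rU; have [->|r0] := eqVneq r 0; first by exists 0; rewrite mul0r.
have r1 : ~ principal r 1.
  by case=> a e; move/negP: rU; apply; apply/unitrPr; exists a; rewrite mulrC -e.
have [I Imax Ir] := maximal_ideal_above r1.
have [J [_ Juniq]] := R_dvr.2.
have nz (A : set R) x : A x -> x != 0 -> A <> [set 0]%classic.
  by move=> Ax x0 A0; rewrite A0 in Ax; rewrite Ax eqxx in x0.
have eI : J = I by apply: Juniq; split; [apply: maximal_prime | apply: nz Ir r0].
have tt : principal t t by exists 1; rewrite mul1r.
have eT : J = principal t.
  by apply: Juniq; split; [apply: maximal_prime | apply: nz tt uniformizer_neq0].
by move: Ir; rewrite -eI eT.
Qed.

Lemma unit_of_ndvd (r : R) : (forall a, r <> a * t) -> r \is a GRing.unit.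
Proof. by move=> h; apply: contrapT => /negP /nonunit_dvd [a /h]. Qed.

Lemma unit_1_sub (a : R) : 1 - a * t \is a GRing.unit.
Proof.
apply: unit_of_ndvd => b e.
have : t \is a GRing.unit.
  apply/unitrPr; exists (a + b); rewrite mulrC mulrDl -e; ring.
by rewrite (negPf uniformizer_nunit).
Qed.

(** Otherwise [c] is divisible by all powers of [t]. Let [g] generate the ideal
    of the [x] with some [x * t ^+ n] in [(c)], say [g * t ^+ n = a * c]. The
    quotient of [c] by [t ^+ n.+1] is again a multiple of [g], so that
    [g * t ^+ n] is divisible by [g * t ^+ n.+1] and [t] is a unit. *)
Lemma unit_power_decomposition (c : R) : c != 0 -> exists n u, u \is a GRing.unit /\ c = t ^+ n * u.
Proof.
move=> c0; have t0 := uniformizer_neq0.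
have [[n nP]|h] := pselect (exists n, forall r, c <> t ^+ n * r).
  elim: n nP => [|n IH] nP; first by case: (nP c); rewrite expr0 mul1r.
  have [[r rE]|nr] := pselect (exists r, c = t ^+ n * r); last first.
    by apply: IH => r rE; apply: nr; exists r.
  exists n, r; split=> //; apply: unit_of_ndvd => a ra.
  by apply: (nP a); rewrite rE ra exprSr; ring.
have cn n : exists r, c = t ^+ n * r.
  by apply: contrapT => nr; apply: h; exists n => r rE; apply: nr; exists r.
pose J : set R := [set x | exists n a, x * t ^+ n = a * c].
have JI : is_ideal J.
  split; first by exists 0, 0; rewrite !mul0r.
  move=> b x y [n [a xE]] [m [a' yE]].
  exists (n + m)%N, (b * a * t ^+ m + a' * t ^+ n).
  have -> : (b * x + y) * t ^+ (n + m) =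
     b * (x * t ^+ n) * t ^+ m + (y * t ^+ m) * t ^+ n by rewrite exprD; ring.
  by rewrite xE yE; ring.
have [g gE] := R_dvr.1 J JI.
have [n [a ga]] : J g by rewrite gE; exists 1; rewrite mul1r.
have [r rE] := cn n.+1.
have [b rb] : principal g r.
  by rewrite -gE; exists n.+1, 1; rewrite mul1r mulrC.
have g0 : g != 0.
  by apply: contra_neq c0 => g0; rewrite rE rb g0 !mulr0.
have tn0 : t ^+ n != 0 by rewrite expf_neq0.
have : t \is a GRing.unit.
  apply/unitrPr; exists (a * b); apply: (mulfI (mulf_neq0 g0 tn0)).
  rewrite mulr1 [RHS]ga rE rb exprS; ring.
by rewrite (negPf uniformizer_nunit).
Qed.

Definition valuation (c : R) : nat :=
  if pselect (exists n, exists u, u \is a GRing.unit /\ c = t ^+ n * u) is left h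
  then projT1 (cid h) else 0%N.

Lemma valuationP (c : R) : c != 0 -> exists2 u, u \is a GRing.unit & c = t ^+ valuation c * u.
Proof.
move=> /unit_power_decomposition h; rewrite /valuation; case: pselect => // h'.
by have [u [uU uE]] := projT2 (cid h'); exists u.
Qed.

Lemma expr_dvdE (c : R) n : c != 0 -> (exists r, c = t ^+ n * r) <-> (n <= valuation c)%N.
Proof.
move=> c0; have [u uU uE] := valuationP c0; split=> [[r rE]|nv]; last first.
  by exists (t ^+ (valuation c - n) * u); rewrite mulrA -exprD subnKC.
rewrite leqNgt; apply/negP => ltn.
have : u = t * (t ^+ (n - valuation c).-1 * r).
  apply: (mulfI (expf_neq0 (valuation c) uniformizer_neq0)).
  rewrite -uE {1}rE mulrA -exprSr mulrA -exprD; congr (t ^+ _ * _).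
  by rewrite addSnnS prednK ?subnKC ?subn_gt0 // ltnW.
by move=> e; move: uU; rewrite e unitrM (negPf uniformizer_nunit).
Qed.

End DiscreteValuationRing.

(** * Linear categories and biproducts *)

Lemma choose_family (T : Type) (U : T -> Type) (P : forall x, U x -> Prop) :
  (forall x, exists y, P x y) -> exists f : forall x, U x, forall x, P x (f x).
Proof.
move=> h; exists (fun x => projT1 (cid (h x))) => x; exact: projT2 (cid (h x)).
Qed.

Section LinearCategories.
Variable k : nzRingType.
Implicit Types C D : lincat k.

Section CompLinear.
Variables (C : lincat k) (X Y Z : C).

Lemma compDl (g g' : hom C Y Z) (f : hom C X Y) :
  comp (g + g') f = comp g f + comp g' f.
Proof. exact: (linearD (mk_linear (@comp_linl k C X Y Z f))). Qed.
Lemma compDr (g : hom C Y Z) (f f' : hom C X Y) :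
  comp g (f + f') = comp g f + comp g f'.
Proof. exact: (linearD (mk_linear (@comp_linr k C X Y Z g))). Qed.
Lemma comp0l (f : hom C X Y) : comp (0 : hom C Y Z) f = 0.
Proof. exact: (linear0 (mk_linear (@comp_linl k C X Y Z f))). Qed.
Lemma comp0r (g : hom C Y Z) : comp g (0 : hom C X Y) = 0.
Proof. exact: (linear0 (mk_linear (@comp_linr k C X Y Z g))). Qed.
Lemma compBl (g g' : hom C Y Z) (f : hom C X Y) :
  comp (g - g') f = comp g f - comp g' f.
Proof. exact: (linearB (mk_linear (@comp_linl k C X Y Z f))). Qed.
Lemma compBr (g : hom C Y Z) (f f' : hom C X Y) :
  comp g (f - f') = comp g f - comp g f'.
Proof. exact: (linearB (mk_linear (@comp_linr k C X Y Z g))). Qed.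
Lemma compZl a (g : hom C Y Z) (f : hom C X Y) : comp (a *: g) f = a *: comp g f.
Proof. exact: (linearZ_LR (mk_linear (@comp_linl k C X Y Z f))). Qed.
Lemma compZr a (g : hom C Y Z) (f : hom C X Y) : comp g (a *: f) = a *: comp g f.
Proof. exact: (linearZ_LR (mk_linear (@comp_linr k C X Y Z g))). Qed.
Lemma comp_suml I (s : seq I) (P : pred I) (g : I -> hom C Y Z) (f : hom C X Y) :
  comp (\sum_(i <- s | P i) g i) f = \sum_(i <- s | P i) comp (g i) f.
Proof. exact: (linear_sum (mk_linear (@comp_linl k C X Y Z f))). Qed.
Lemma comp_sumr I (s : seq I) (P : pred I) (g : hom C Y Z) (f : I -> hom C X Y) :
  comp g (\sum_(i <- s | P i) f i) = \sum_(i <- s | P i) comp g (f i).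
Proof. exact: (linear_sum (mk_linear (@comp_linr k C X Y Z g))). Qed.
End CompLinear.

Lemma equivalent_of_fully_faithful C D (F : linfunctor C D) :
    (forall X Y, injective (@fmap k C D F X Y)) ->
    (forall X Y (g : hom D (F X) (F Y)), exists f, fmap F f = g) ->
    (forall W, exists X (u : hom D (F X) W), is_iso u) ->
  equivalent_lincat D C.
Proof.
move=> Finj Fsurj Fes.
have [ob obP] := choice Fes; have [u uP] := choose_family obP.
have [v vP] := choose_family uP.
have Fsec X Y : exists h : hom D (F X) (F Y) -> hom C X Y,
    cancel h (@fmap k C D F X Y).
  by have [h hP] := choice (@Fsurj X Y); exists h.
pose pre X Y := projT1 (cid (Fsec X Y)).
have preK X Y g : fmap F (pre X Y g) = g by apply: (projT2 (cid (Fsec X Y))).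
pose Gm W W' (f : hom D W W') := pre (ob W) (ob W') (comp (v W') (comp f (u W))).
have GmL W W' : linear (@Gm W W').
  move=> a f g; apply: Finj; rewrite linearP !preK.
  by rewrite compDl compDr compZl compZr.
have Gm1 W : mk_linear (@GmL W W) (idm W) = idm (ob W).
  by apply: Finj; rewrite preK comp1m (vP W).1 fmap1.
have GmM W1 W2 W3 (g : hom D W2 W3) (f : hom D W1 W2) :
    mk_linear (@GmL W1 W3) (comp g f) =
    comp (mk_linear (@GmL W2 W3) g) (mk_linear (@GmL W1 W2) f).
  apply: Finj; rewrite fmapM !preK -!compA; congr comp; congr comp.
  by rewrite compA (vP W2).2 comp1m.
pose G := LinFunctor Gm1 GmM.
exists G, F; split.
  exists u => [W|W W' f]; first by exists (v W); apply: vP.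
  by rewrite /= preK !compA (vP W').2 comp1m.
exists (fun X => pre (ob (F X)) X (u (F X))) => [X|X Y f].
  exists (pre X (ob (F X)) (v (F X))).
  by split; apply: Finj; rewrite fmapM !preK fmap1; [apply: (vP _).1 | apply: (vP _).2].
by apply: Finj; rewrite !fmapM !preK /= !compA (vP _).2 comp1m.
Qed.

(** [W] is the biproduct of the family [X], in the equational form that every
    linear functor preserves. *)
Definition biproduct C (I : finType) (X : I -> C) (W : C)
    (s : forall i, hom C (X i) W) (r : forall i, hom C W (X i)) : Prop :=
  [/\ forall i, comp (r i) (s i) = idm (X i),
      forall i j, i != j -> comp (r j) (s i) = 0
    & \sum_i comp (s i) (r i) = idm W].

Definition is_biproduct C (I : finType) (X : I -> C) (W : C) : Prop :=
  exists s r, @biproduct C I X W s r.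

(** The hull is embedded by a choice of biproducts; a morphism between two
    biproducts is the same as the matrix of its components, so full faithfulness
    is inherited entrywise. *)
Section Hull.
Variables (C D : lincat k) (F : linfunctor C D).
Hypothesis Finj : forall X Y, injective (@fmap k C D F X Y).
Hypothesis Fsurj : forall X Y (g : hom D (F X) (F Y)), exists f, fmap F f = g.
Hypothesis Fsum : forall n (X : 'I_n -> C),
  exists W : D, is_biproduct (fun i => F (X i)) W.
Hypothesis Fdec : forall W : D,
  exists n (X : 'I_n -> C), is_biproduct (fun i => F (X i)) W.

Lemma equivalent_hull : equivalent_lincat D (additive_hull C).
Proof.
have sumE (X : formal_sum C) : exists W : D, is_biproduct (fun i => F (X i)) W.
  exact: Fsum.
have [ob /choose_family [s /choose_family [r bp]]] := choice sumE.
pose Pm (X Y : formal_sum C) (f : mxhom X Y) : hom D (ob X) (ob Y) :=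
  \sum_i \sum_j comp (s Y j) (comp (fmap F (entry f i j)) (r X i)).
have PmE (X Y : formal_sum C) (f : mxhom X Y) i j :
    comp (r Y j) (comp (Pm X Y f) (s X i)) = fmap F (entry f i j).
  have [rs1 _ _] := bp X; have [rs1' _ _] := bp Y.
  have [_ rs0 _] := bp X; have [_ rs0' _] := bp Y.
  rewrite comp_suml comp_sumr (bigD1 i) //= [X in _ + X]big1 => [|i' ii'].
    rewrite addr0 comp_suml comp_sumr (bigD1 j) //= [X in _ + X]big1 => [|j' jj'].
      by rewrite addr0 -!compA rs1 compm1 compA rs1' comp1m.
    by rewrite -!compA rs1 compm1 compA rs0' // comp0l.
  rewrite comp_suml comp_sumr big1 // => j' _.
  by rewrite -!compA rs0 1?eq_sym // !comp0r.
have bpP (X Y : formal_sum C) (f g : hom D (ob X) (ob Y)) :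
    (forall i j, comp (r Y j) (comp f (s X i)) = comp (r Y j) (comp g (s X i))) ->
    f = g.
  move=> fg; have [_ _ i1] := bp X; have [_ _ j1] := bp Y.
  rewrite -[f]compm1 -[g]compm1 -[f]comp1m -[g]comp1m -i1 -j1 !comp_sumr.
  apply: eq_bigr => i _; rewrite !comp_suml; apply: eq_bigr => j _.
  by have := congr1 (fun h => comp (s Y j) (comp h (r X i))) (fg i j); rewrite -!compA.
have PmL X Y : linear (@Pm X Y).
  move=> a f g; apply: bpP => i j.
  by rewrite compDl compDr compZl compZr !PmE -linearP.
have mxid_diag (X : formal_sum C) i : entry (@mxid k C X) i i = idm (X i).
  by rewrite /entry /mxid; case: eqP => // e; rewrite eq_axiomK.
have mxid_off (X : formal_sum C) i j : i != j -> entry (@mxid k C X) i j = 0.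
  by rewrite /entry /mxid; case: eqP.
have Pm1 X : mk_linear (@PmL X X) (@mxid k C X) = idm (ob X).
  apply: bpP => i j; rewrite PmE comp1m; have [rs1 rs0 _] := bp X.
  have [<-|ij] := eqVneq i j; first by rewrite mxid_diag fmap1 rs1.
  by rewrite mxid_off // linear0 rs0.
have PmM X Y Z (g : mxhom Y Z) (f : mxhom X Y) :
    mk_linear (@PmL X Z) (mxcomp g f) =
    comp (mk_linear (@PmL Y Z) g) (mk_linear (@PmL X Y) f).
  apply: bpP => i l; rewrite PmE /= linear_sum /=.
  have -> : comp (mk_linear (@PmL Y Z) g) (mk_linear (@PmL X Y) f) =
      \sum_j comp (comp (Pm Y Z g) (s Y j)) (comp (r Y j) (Pm X Y f)).
    rewrite -[LHS](congr1 (fun h => comp h _) (compm1 _)); have [_ _ <-] := bp Y.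
    rewrite comp_sumr comp_suml; apply: eq_bigr => j _.
    by rewrite -!compA.
  rewrite comp_suml comp_sumr; apply: eq_bigr => j _.
  by rewrite fmapM -!PmE -!compA.
pose P : linfunctor (additive_hull C) D := @LinFunctor k (additive_hull C) D ob
  (fun X Y => mk_linear (@PmL X Y)) Pm1 PmM.
apply: (@equivalent_of_fully_faithful _ _ P).
- move=> X Y f g fg; apply: mxhomP => i j; apply: Finj.
  by rewrite -!PmE; congr (comp _ (comp _ _)).
- move=> X Y g.
  have h i j : exists f : hom C (X i) (Y j),
      fmap F f = comp (r Y j) (comp g (s X i)) by apply: Fsurj.
  have [f fE] := choose_family (fun i => choose_family (h i)).
  by exists (f : mxhom X Y); apply: bpP => i j; rewrite PmE fE.
- move=> W; have [n [X [s' [r' [rs1 rs0 sr1]]]]] := Fdec W.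
  pose Y : formal_sum C := FormalSum X; have [rs1' rs0' sr1'] := bp Y.
  exists Y, (\sum_i comp (s' i) (r Y i)), (\sum_i comp (s Y i) (r' i)); split.
    rewrite -[RHS]sr1' comp_suml; apply: eq_bigr => i _.
    rewrite comp_sumr (bigD1 i) //= big1 => [|j ji].
      by rewrite addr0 -compA (compA (r' i)) rs1 comp1m.
    by rewrite -compA (compA (r' i)) rs0 // comp0l comp0r.
  rewrite -sr1 comp_suml; apply: eq_bigr => i _.
  rewrite comp_sumr (bigD1 i) //= big1 => [|j ji].
    by rewrite addr0 -compA (compA (r Y i)) rs1' comp1m.
  by rewrite -compA (compA (r Y i)) rs0' // comp0l comp0r.
Qed.
End Hull.
End LinearCategories.

Section Biproducts.
Variable k : nzRingType.

Lemma biproduct_fmap (C D : lincat k) (F : linfunctor C D) (I : finType) (X : I -> C) W :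
  is_biproduct X W -> is_biproduct (fun i => F (X i)) (F W).
Proof.
case=> s [r [rs1 rs0 sr1]]; exists (fun i => fmap F (s i)), (fun i => fmap F (r i)).
split=> [i|i j ij|].
- by rewrite -fmapM rs1 fmap1.
- by rewrite -fmapM rs0 // linear0.
- by rewrite -fmap1 -sr1 linear_sum; apply: eq_bigr => i _; rewrite fmapM.
Qed.

Lemma complement_idempotent (C : lincat k) (I : finType) (X : I -> C) W
    (s : forall i, hom C (X i) W) (r : forall i, hom C W (X i)) :
    (forall i, comp (r i) (s i) = idm (X i)) ->
    (forall i j, i != j -> comp (r j) (s i) = 0) ->
  let e := idm W - \sum_i comp (s i) (r i) in
  [/\ forall j, comp e (s j) = 0, forall j, comp (r j) e = 0 & comp e e = e].
Proof.
move=> rs1 rs0 e.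
have es j : comp e (s j) = 0.
  rewrite compBl comp1m comp_suml (bigD1 j) //= big1 => [|i ij].
    by rewrite addr0 -compA rs1 compm1 subrr.
  by rewrite -compA rs0 1?eq_sym // comp0r.
have re j : comp (r j) e = 0.
  rewrite compBr compm1 comp_sumr (bigD1 j) //= big1 => [|i ij].
    by rewrite addr0 compA rs1 comp1m subrr.
  by rewrite compA rs0 // comp0l.
split=> //; rewrite {2}/e compBr compm1 comp_sumr big1 ?subr0 // => i _.
by rewrite compA es comp0l.
Qed.

Lemma biproduct_support (C : lincat k) (I : finType) (X : I -> C) W (A : {pred I}) :
    (forall i, i \notin A -> idm (X i) = 0) -> is_biproduct X W ->
  is_biproduct (fun i : 'I_#|A| => X (enum_val i)) W.
Proof.
move=> X0 [s [r [rs1 rs0 sr1]]].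
exists (fun i => s (enum_val i)), (fun i => r (enum_val i)).
split=> [i|i j ij|]; first exact: rs1.
  by apply: rs0; apply: contra_neq ij => /enum_val_inj.
rewrite -sr1 [RHS](bigID [in A]) /= [X in _ + X]big1 => [|i /X0 i0].
  by rewrite addr0 [RHS]big_enum_val.
by rewrite -[s i]compm1 i0 comp0r comp0l.
Qed.

Lemma finite_biproducts (C : lincat k) :
    (exists Z : C, idm Z = 0) ->
    (forall X Y : C, exists W (i : hom C X W) (j : hom C Y W)
        (p : hom C W X) (q : hom C W Y),
      [/\ comp p i = idm X, comp q j = idm Y, comp q i = 0, comp p j = 0
        & comp i p + comp j q = idm W]) ->
  forall (I : finType) (X : I -> C), exists W, is_biproduct X W.
Proof.
case=> Z Z0 bin I X.
suff: forall l : seq I, uniq l -> exists W (s : forall i, hom C (X i) W)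
    (r : forall i, hom C W (X i)),
  [/\ forall i, i \in l -> comp (r i) (s i) = idm (X i),
      forall i j, i != j -> comp (r j) (s i) = 0
    & \sum_(i <- l) comp (s i) (r i) = idm W].
  case/(_ (enum I) (enum_uniq _)) => W [s [r [rs1 rs0 sr1]]].
  exists W, s, r; split=> // [i|]; first by apply: rs1; rewrite mem_enum.
  by rewrite -sr1 big_enum.
elim=> [_|i0 l IH /andP[i0l /IH [W [s [r [rs1 rs0 sr1]]]]]].
  exists Z, (fun=> 0), (fun=> 0); split=> // [i j _|]; first by rewrite comp0l.
  by rewrite big_nil Z0.
have [W' [i1 [j1 [p1 [q1 [pi qj qi pj ipjq]]]]]] := bin (X i0) W.
pose s' i : hom C (X i) W' := match i0 =P i with
  | ReflectT e => ecast j (hom C (X j) W') e i1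
  | ReflectF _ => comp j1 (s i) end.
pose r' i : hom C W' (X i) := match i0 =P i with
  | ReflectT e => ecast j (hom C W' (X j)) e p1
  | ReflectF _ => comp (r i) q1 end.
have s'1 : s' i0 = i1 by rewrite /s'; case: eqP => // e; rewrite eq_axiomK.
have r'1 : r' i0 = p1 by rewrite /r'; case: eqP => // e; rewrite eq_axiomK.
have s'N i : i != i0 -> s' i = comp j1 (s i).
  by rewrite /s'; case: eqP => // e /eqP; case.
have r'N i : i != i0 -> r' i = comp (r i) q1.
  by rewrite /r'; case: eqP => // e /eqP; case.
exists W', s', r'; split=> [i|i j ij|].
- rewrite inE; have [->|ii0 /= il] := eqVneq i i0; first by rewrite s'1 r'1.
  by rewrite s'N // r'N // -compA (compA q1) qj comp1m rs1.
- have [ii0|ii0] := eqVneq i i0.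
    subst i; rewrite s'1 r'N 1?eq_sym // -compA qi comp0r //.
  have [ji0|ji0] := eqVneq j i0.
    by subst j; rewrite s'N // r'1 compA pj comp0l.
  by rewrite s'N // r'N // -compA (compA q1) qj comp1m rs0.
- rewrite big_cons s'1 r'1 -ipjq; congr (_ + _).
  rewrite -[q1]comp1m -sr1 comp_suml comp_sumr big_seq [RHS]big_seq.
  apply: eq_bigr => i il; have ii0 : i != i0 by apply: contraNneq i0l => <-.
  by rewrite s'N // r'N // -!compA.
Qed.

End Biproducts.


(** * Arrows on the circle *)

Section Circle.
Variable RR : realType.
Local Notation S1 := (circle RR).
Local Notation tau := (tau RR).
Implicit Types (p q r : S1) (a b : RR).

Lemma cls_tau : cls tau = 0.
Proof. by rewrite -(cls0 RR); apply/clsP; exists 1; rewrite mulr1 add0r. Qed.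

Lemma ang_uniq p a : 0 <= a < tau -> cls a = p -> ang p = a.
Proof.
move=> /andP[a0 at_] <-; have /andP[b0 bt] := ang_itv (cls a).
have /clsP[n nE] := angK (cls a).
have [h|h|h|h] := tau_int RR n; move: nE.
- by rewrite h mulr0 addr0.
- by rewrite h mulrN1z mulrN mulr1; lra.
- lra.
- by have := tau_gt0 RR; lra.
Qed.

Lemma ang0 : ang (0 : S1) = 0.
Proof. by apply: ang_uniq; rewrite ?cls0 // lexx tau_gt0. Qed.

Lemma ang_ge0 p : 0 <= ang p. Proof. by case/andP: (ang_itv p). Qed.
Lemma ang_lt p : ang p < tau. Proof. by case/andP: (ang_itv p). Qed.

Lemma angN p : p != 0 -> ang (- p) = tau - ang p.
Proof.
move=> p0; have /andP[a0 at_] := ang_itv p.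
have a1 : ang p != 0.
  by apply: contraNneq p0 => e; rewrite -[p]angK e cls0.
apply: ang_uniq; last by rewrite clsB cls_tau angK sub0r.
have h : 0 < ang p by rewrite lt_neqAle eq_sym a1.
by apply/andP; split; lra.
Qed.

Lemma arrowE p q a : arrow p q a -> q = p - cls a.
Proof. by case/andP => _ /eqP. Qed.
Lemma arrow_ge0 p q a : arrow p q a -> 0 <= a.
Proof. by case/andP. Qed.
Lemma arrow_add p q a : 0 <= a -> p = q + cls a -> arrow p q a.
Proof. by move=> a0 ->; rewrite /arrow a0 addrK /=. Qed.
Lemma arrow_comp p q r a b c : arrow p q b -> arrow q r a -> c = a + b -> arrow p r c.
Proof.
move=> /andP[b0 /eqP ->] /andP[a0 /eqP ->] ->.
by rewrite /arrow addr_ge0 //= clsD opprD addrA addrAC.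
Qed.
Lemma arrow_ang p q : arrow p q (ang (p - q)).
Proof. by rewrite /arrow ang_ge0 angK opprB addrC subrK /=. Qed.
Lemma arrow_id p : arrow p p 0.
Proof. by rewrite /arrow lexx cls0 subr0 /=. Qed.
Lemma arrow_turns p n : arrow p p (tau * n%:R).
Proof.
rewrite /arrow mulr_ge0 ?(ltW (tau_gt0 RR)) //= eq_sym.
have -> : cls (tau * n%:R) = 0; last by rewrite subr0.
by rewrite -(cls0 RR); apply/clsP; exists (n : int); rewrite add0r.
Qed.
Lemma arrow_turn p : arrow p p tau.
Proof. by rewrite -[tau]mulr1; apply: (arrow_turns p 1). Qed.

Lemma ang_arrow p q a : arrow p q a -> a < tau -> ang (p - q) = a.
Proof.
move=> h at_; apply: ang_uniq; first by rewrite (arrow_ge0 h).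
by rewrite (arrowE h) opprB addrC subrK.
Qed.

Lemma arrow_angE p q a : arrow p q a -> a = ang (p - q) + tau * (wind p p a)%:R.
Proof. by move=> h; have := windE p h; rewrite subrr ang0 add0r. Qed.

Lemma wind_ang p q : wind p p (ang (p - q)) = 0%N.
Proof.
have /eqP := arrow_angE (arrow_ang p q); rewrite -subr_eq0 opprD addNKr oppr_eq0.
by rewrite mulf_eq0 (negPf (tau_neq0 RR)) pnatr_eq0 => /eqP.
Qed.

End Circle.


(** * Representations of the circle *)

Section Rep.
Variables (RR : realType) (R : idomainType) (t : R).
Hypothesis t0 : t != 0.
Local Notation S1 := (circle RR).
Local Notation tau := (tau RR).
Local Notation rep := (rep RR t).
Local Notation P_ := (P_ t).
Implicit Types (V W : rep) (p q r z : S1).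

Lemma rep_map_eq V p q a b (h : arrow p q a) (h' : arrow p q b) v :
  a = b -> rep_map V h v = rep_map V h' v.
Proof. by move=> e; subst b; rewrite (bool_irrelevance h h'). Qed.

Lemma rep_map_comp V p q r a b c (h : arrow p q b) (h' : arrow q r a)
    (h'' : arrow p r c) v : c = a + b ->
  rep_map V h' (rep_map V h v) = rep_map V h'' v.
Proof. by move=> e; subst c; rewrite (rep_mapM h h' h''). Qed.

Lemma rep_map_id V p (h : arrow p p 0) v : rep_map V h v = v.
Proof.
rewrite (rep_map_eq h (arrow_turns p 0)) ?mulr0 //.
by rewrite rep_mapX expr0 scale1r.
Qed.

Lemma rep_map_turn V p (h : arrow p p tau) v : rep_map V h v = t *: v.
Proof.
rewrite (rep_map_eq h (arrow_turns p 1)) ?mulr1 //.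
by rewrite rep_mapX expr1.
Qed.

(** The shortest arrow to [q] followed by [h] is the shortest arrow to [r]
    followed by full turns, each of which acts as [t]. *)
Lemma rep_map_wind V p q r b (h : arrow q r b) w :
  rep_map V h (rep_map V (arrow_ang p q) w) =
  t ^+ wind p q b *: rep_map V (arrow_ang p r) w.
Proof.
have e := windE p h.
have h' : arrow p r (ang (p - q) + b).
  by apply: arrow_comp (arrow_ang p q) h _; rewrite addrC.
rewrite (rep_map_comp _ _ h') 1?addrC // -(rep_mapX (arrow_turns r _)).
by rewrite (rep_map_comp _ _ h') // e addrC.
Qed.

Lemma rh_makeE V W (f : forall p, V p -> W p) (fL : forall p, linear (f p)) fN p v :
  rh_make fL fN p v = f p v.
Proof. by []. Qed.

Lemma rep_hom_eq V W (f g : rep_hom V W) p v : f = g -> f p v = g p v.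
Proof. by move=> ->. Qed.

(** A monomorphism through which a morphism factors pointwise gives a global
    factorisation, because the pointwise preimages are unique. *)
Lemma factor_mono V W U (m : rep_hom W U) (f : rep_hom V U) :
    rh_mono m -> (forall p v, exists w, m p w = f p v) ->
  exists g : rep_hom V W, rh_comp m g = f.
Proof.
move=> minj mf.
have [g gE] := choose_family (fun p => choose_family (mf p)).
have gL p : linear (g p).
  by move=> a u v; apply: (minj p); rewrite linearP !gE linearP.
have gN p q a (h : arrow p q a) v : rep_map W h (g p v) = g q (rep_map V h v).
  by apply: (minj q); rewrite -rh_nat !gE rh_nat.
by exists (rh_make gL gN); apply: rep_homP => p v; apply: gE.
Qed.

(** * The representations [P_[p]] *)

Section Yoneda.
Variables (V : rep) (p : S1) (w : V p).
Let f z : P_ p z -> V z := fun v => (v : R) *: rep_map V (arrow_ang p z) w.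
Let fL z : linear (@f z).
Proof.
move=> a u v; rewrite /f scalerA -scalerDl; congr (_ *: _).
Qed.
Let fN z z' a (h : arrow z z' a) v :
  rep_map V h (f v) = f (rep_map (P_ p) h v).
Proof.
by rewrite /f linearZ /= rep_map_wind scalerA mulrC.
Qed.
Definition yoneda : rep_hom (P_ p) V := rh_make fL fN.
Lemma yonedaE z v : yoneda z v = (v : R) *: rep_map V (arrow_ang p z) w.
Proof. by []. Qed.
Lemma yoneda1 : yoneda p (1 : R) = w.
Proof.
by rewrite yonedaE scale1r (rep_map_eq _ (arrow_id p)) ?rep_map_id // subrr ang0.
Qed.
End Yoneda.

Lemma P_mapE p q r b (h : arrow q r b) v :
  rep_map (P_ p) h v = t ^+ wind p q b * (v : R) :> R.
Proof. by []. Qed.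

Lemma hom_PE V p (f : rep_hom (P_ p) V) : f = yoneda (f p (1 : R)).
Proof.
apply: rep_homP => z v; rewrite yonedaE rh_nat P_mapE wind_ang expr0 mul1r.
by rewrite -linearZ; congr (f z _); rewrite /= -[LHS]mulr1.
Qed.

Lemma hom_P_eq V p (f g : rep_hom (P_ p) V) : f p (1 : R) = g p (1 : R) -> f = g.
Proof. by move=> e; rewrite (hom_PE f) (hom_PE g) e. Qed.

Lemma projective_P p : projective (P_ p).
Proof.
move=> W U g f ge; have [w wE] := ge p (f p (1 : R)).
by exists (yoneda w); apply: hom_P_eq; rewrite rh_compE yoneda1.
Qed.

Lemma fin_gen_P p : fin_gen (P_ p).
Proof.
pose f z : rep_dsum (fun _ : 'I_1 => P_ p) z -> P_ p z := fun v => v ord0.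
exists 'I_1, (fun=> p), (@rh_make _ _ _ (rep_dsum (fun _ : 'I_1 => P_ p)) _ f
  (fun _ _ _ _ => erefl) (fun _ _ _ _ _ => erefl)).
by move=> z v; exists (fun=> v).
Qed.

(** The morphism [e_p |-> e_q ^ a]. Written with distances instead of powers of
    [t], such morphisms compose by addition. *)
Definition slide p q a (h : arrow q p a) : rep_hom (P_ p) (P_ q) :=
  yoneda (rep_map (P_ q) h (1 : R)).

Lemma slide1 p q a (h : arrow q p a) : slide h p (1 : R) = rep_map (P_ q) h (1 : R).
Proof. exact: yoneda1. Qed.

Lemma slideE p q a (h : arrow q p a) z v : slide h z v = t ^+ wind p z a * (v : R) :> R.
Proof.
rewrite yonedaE.
have h' : arrow q z (ang (p - z) + a) by apply: arrow_comp h (arrow_ang p z) _.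
rewrite (rep_map_comp h (arrow_ang p z) h') //.
rewrite P_mapE mulr1 [LHS]mulrC; congr (t ^+ _ * _).
by rewrite /wind subrr ang0 add0r.
Qed.

Lemma slide_comp p q r a b c (h : arrow q p a) (h' : arrow r q b) (h'' : arrow r p c) :
  c = a + b -> rh_comp (slide h') (slide h) = slide h''.
Proof.
move=> e; apply: hom_P_eq; rewrite rh_compE !slide1 -rh_nat slide1.
exact: rep_map_comp.
Qed.

Lemma slide_turn p (h : arrow p p tau) : slide h = t *: rh_id (P_ p).
Proof. by apply: hom_P_eq; rewrite slide1 rep_map_turn. Qed.

Lemma slide_id p (h : arrow p p 0) : slide h = rh_id (P_ p).
Proof. by apply: hom_P_eq; rewrite slide1 rep_map_id. Qed.

Lemma slide_mono p q a (h : arrow q p a) : rh_mono (slide h).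
Proof.
move=> z u v; rewrite !slideE => /mulfI; apply.
by rewrite expf_neq0.
Qed.

Lemma hom_PP p q (f : rep_hom (P_ p) (P_ q)) : f = (f p (1 : R) : R) *: slide (arrow_ang q p).
Proof.
apply: hom_P_eq; rewrite rh_ZE slide1 P_mapE wind_ang expr0 mul1r.
exact: esym (mulr1 _).
Qed.

(** * Finitely generated projective representations *)

Lemma projective_retract V : fin_gen V -> projective V ->
  exists (I : finType) (x : I -> S1) (i : rep_hom V (rep_dsum (fun k => P_ (x k))))
    (g : rep_hom (rep_dsum (fun k => P_ (x k))) V), rh_comp g i = rh_id V.
Proof.
by case=> I [x [g ge]] Vp; have [i iE] := Vp _ _ g (rh_id V) ge; exists I, x, i, g.
Qed.

(** [V] embeds into a sum of representations [P_[x]], on which the structure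
    maps are multiplications by powers of [t]. *)
Lemma rep_map_inj V p q a (h : arrow p q a) : fin_gen V -> projective V ->
  injective (rep_map V h).
Proof.
move=> Vf Vp; have [I [x [i [g gi]]]] := projective_retract Vf Vp.
move=> u v e; rewrite -[u]/(rh_id V p u) -[v]/(rh_id V p v) -gi !rh_compE.
congr (g p _); apply: dsumP => k.
have /(congr1 (fun w => w k)) : i q (rep_map V h u) = i q (rep_map V h v) by rewrite e.
rewrite -!rh_nat; apply: mulfI; by rewrite expf_neq0.
Qed.

Lemma scale_t_inj V p : fin_gen V -> projective V -> injective (fun v : V p => t *: v).
Proof.
move=> Vf Vp u v; rewrite -!(rep_map_turn (arrow_turn p)).
exact: rep_map_inj.
Qed.

End Rep.

(** * Stably zero morphisms *)

Section Homotopy.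
Variables (RR : realType) (R : idomainType) (t : R).
Local Notation rep := (rep RR t).
Local Notation frob := (frob RR t).

Lemma frob_dd (X : frob) p v : fr_d X p (fr_d X p v) = t *: v.
Proof. exact: (rep_hom_eq v (fr_dd X)). Qed.

(** [W + W] with [d (a, b) = (t b, a)] is induced and coinduced from [W]: the
    morphisms from it to [Y] and to it from [X] are given by morphisms of
    representations from [W] to [Y] and from [X] to [W]. *)
Section Double.
Variables (W : rep) (Wf : fin_gen W) (Wp : projective W).
Let d p : rep_sum W W p -> rep_sum W W p := fun v => (t *: v.2, v.1).
Let dL p : linear (@d p).
Proof.
move=> a [u u'] [v v']; congr pair.
by rewrite /= scalerDr !scalerA mulrC.
Qed.
Let dN p q a (h : arrow p q a) v :
  rep_map (rep_sum W W) h (d v) = d (rep_map (rep_sum W W) h v).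
Proof. by case: v => v v'; congr pair; apply: linearZ. Qed.
Let dd : rh_comp (rh_make dL dN) (rh_make dL dN) = t *: rh_id (rep_sum W W).
Proof. by apply: rep_homP => p [v v']. Qed.
Definition double : frob :=
  Frob (fin_gen_sum Wf Wf) (projective_sum Wp Wp) dd.

Lemma double_dE p v : fr_d double p v = (t *: v.2, v.1). Proof. by []. Qed.

Section Extend.
Variables (Y : frob) (k : rep_hom W Y).
Let f p : double p -> Y p := fun v => k p v.1 + fr_d Y p (k p v.2).
Let fL p : linear (@f p).
Proof.
move=> a [u u'] [v v']; rewrite /f /= !linearP scalerDr.
by rewrite -!addrA; congr (_ + _); rewrite addrCA.
Qed.
Let fN p q a (h : arrow p q a) v : rep_map Y h (f v) = f (rep_map double h v).
Proof. by case: v => v v'; rewrite /f linearD /= !rh_nat. Qed.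
Let fC p v : rh_make fL fN p (fr_d double p v) = fr_d Y p (rh_make fL fN p v).
Proof.
case: v => v v'; rewrite double_dE !rh_makeE /f /= linearD frob_dd linearZ.
by rewrite addrC.
Qed.
Definition from_double : frob_hom double Y := fh_make fC.
Lemma from_doubleE p v : from_double p v = k p v.1 + fr_d Y p (k p v.2).
Proof. by []. Qed.
End Extend.

Section CoExtend.
Variables (X : frob) (k : rep_hom X W).
Let f p : X p -> double p := fun v => (k p (fr_d X p v), k p v).
Let fL p : linear (@f p).
Proof. by move=> a u v; rewrite /f !linearP. Qed.
Let fN p q a (h : arrow p q a) v : rep_map double h (f v) = f (rep_map X h v).
Proof. by rewrite /f -!rh_nat. Qed.
Let fC p v : rh_make fL fN p (fr_d X p v) = fr_d double p (rh_make fL fN p v).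
Proof. by rewrite double_dE !rh_makeE /f frob_dd linearZ. Qed.
Definition to_double : frob_hom X double := fh_make fC.
Lemma to_doubleE p v : to_double p v = (k p (fr_d X p v), k p v).
Proof. by []. Qed.
End CoExtend.

Lemma double_projective : frob_projective double.
Proof.
move=> X Y Z f g h [_ _ ge].
have [k kE] := Wp (rh_comp h (rh_inl W W)) ge.
have gk p v : g p (k p v) = h p (v, 0) by apply: (rep_hom_eq v kE).
exists (from_double k); apply: frob_homP => p [v v'].
rewrite fh_compE from_doubleE linearD /= frob_homC !gk -frob_homC double_dE /=.
by rewrite -linearD; congr (h p _); congr pair; rewrite ?scaler0 ?addr0 ?add0r.
Qed.

(** The epimorphism of an exact sequence onto [Z] splits on representations, as
    [Z] is projective there, so its monomorphism has a retraction [r], not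
    necessarily commuting with [d]; this is enough to extend a morphism to a
    coinduced object. *)
Lemma double_injective : frob_injective double.
Proof.
move=> X Y Z f g h [fm fg ge].
have [s sE] := @fr_proj _ _ _ Z _ _ g (rh_id Z) ge.
have gs p v : g p (s p v) = v by apply: (rep_hom_eq v sE).
have [|r rE] := @factor_mono _ _ t Y X Y f (rh_id Y - rh_comp s g) fm.
  move=> p v; apply/fg; rewrite -[X in g p X]/(v - s p (g p v)).
  by rewrite linearB /= gs subrr.
have rf p v : r p (f p v) = v.
  apply: (fm p); have := rep_hom_eq (f p v) rE; rewrite rh_compE => ->.
  rewrite -[LHS]/(f p v - s p (g p (f p v))).
  by have -> : g p (f p v) = 0; [apply/fg; exists v | rewrite linear0 subr0].
exists (to_double (rh_comp (rh_snd W W) (rh_comp h r))); apply: frob_homP => p v.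
rewrite fh_compE to_doubleE !rh_compE -frob_homC !rf.
rewrite -[LHS]/((h p (fr_d X p v)).2, (h p v).2) frob_homC double_dE /=.
by case: (h p v).
Qed.

End Double.

Definition null_homotopic (X Y : frob) (f : frob_hom X Y) : Prop :=
  exists h : rep_hom X Y, forall p v, f p v = h p (fr_d X p v) + fr_d Y p (h p v).

Section Negate.
Variable X : frob.
Let dd : rh_comp (- fr_d X) (- fr_d X) = t *: rh_id X.
Proof.
apply: rep_homP => p v; rewrite -[LHS]/(- fr_d X p (- fr_d X p v)).
by rewrite linearN opprK frob_dd.
Qed.
Definition frob_neg : frob := Frob (fr_fg X) (@fr_proj _ _ _ X) dd.
End Negate.

(** The map [(a, b) |-> a + d b] from the double of [X] onto [X] has kernel
    [(X, - d)], so it belongs to an exact sequence and splits. The second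
    component [k] of a section satisfies [k d + d k = 1]. *)
Lemma projective_contractible (X : frob) : frob_projective X ->
  null_homotopic (fh_id X).
Proof.
move=> Xp; pose D := double (fr_fg X) (@fr_proj _ _ _ X).
pose g : frob_hom D X := from_double _ _ (rh_id X).
pose f p : frob_neg X p -> D p := fun v => (- fr_d X p v, v).
have fL p : linear (@f p).
  by move=> a u v; rewrite /f linearP opprD -scalerN.
have fN p q a (h : arrow p q a) v : rep_map D h (f p v) = f q (rep_map X h v).
  by congr pair; rewrite linearN rh_nat.
have fC p v : rh_make fL fN p (fr_d (frob_neg X) p v) = fr_d D p (rh_make fL fN p v).
  rewrite -[LHS]/(- fr_d X p (- fr_d X p v), - fr_d X p v).
  by rewrite -[RHS]/(t *: v, - fr_d X p v) linearN opprK frob_dd.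
have gE p v : g p v = v.1 + fr_d X p v.2 by [].
have ex : frob_exact (fh_make fC) g.
  split.
  - by move=> p u v [].
  - move=> p [v v']; rewrite gE /=; split; last first.
      by case=> u [<- <-]; rewrite addNr.
    move=> e; exists v'; congr pair.
    by apply/eqP; rewrite eq_sym -addr_eq0 e.
  - by move=> p v; exists (v, 0); rewrite gE /= linear0 addr0.
have [k kE] := Xp _ _ _ _ _ (fh_id X) ex.
exists (rh_comp (rh_snd X X) k) => p v; rewrite rh_compE.
have e u : k p u = ((k p u).1, (k p u).2) by case: (k p u).
have -> : rh_snd X X p (k p (fr_d X p v)) = (k p v).1 by rewrite frob_homC.
rewrite -[RHS]/((k p v).1 + fr_d X p (k p v).2) -gE.
by rewrite -[RHS]/(fh_comp g k p v) kE.
Qed.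

(** A projective object is contractible, so whatever factors through it is
    null-homotopic; conversely [h d + d h] factors through the double of its
    source. *)
Lemma stably_zeroP (X Y : frob) (f : frob_hom X Y) :
  stably_zero f <-> null_homotopic f.
Proof.
split=> [/asboolP[P [u [v [Pp _ ->]]]]|[h hE]].
  have [k kE] := projective_contractible Pp.
  exists (rh_comp v (rh_comp k u)) => p x; rewrite fh_compE !rh_compE.
  rewrite {1}[u p x](kE p) linearD; congr (_ + _); last by rewrite frob_homC.
  by rewrite frob_homC.
apply/asboolP; exists (double (fr_fg X) (@fr_proj _ _ _ X)).
exists (to_double _ _ (rh_id X)), (from_double _ _ h).
split; [exact: double_projective | exact: double_injective |].
by apply: frob_homP => p v; rewrite fh_compE hE.
Qed.

Lemma null_homotopic_comp (X Y Z W : frob) (h : frob_hom Z W) (g : frob_hom Y Z)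
    (f : frob_hom X Y) :
  null_homotopic g -> null_homotopic (fh_comp h (fh_comp g f)).
Proof. by move=> /stably_zeroP gz; apply/stably_zeroP/stably_zero_comp. Qed.

End Homotopy.

(** * Cells and their morphisms *)

Section Cells.
Variables (RR : realType) (R : idomainType) (t : R).
Hypothesis t0 : t != 0.
Local Notation S1 := (circle RR).
Local Notation tau := (tau RR).
Local Notation rep := (rep RR t).
Local Notation P_ := (P_ t).
Local Notation frob := (frob RR t).
Local Notation slide := (slide t).
Implicit Types (p q r z : S1).

Section Diag.
Variables (V W U T : rep) (f : rep_hom V U) (g : rep_hom W T).
Let d p : rep_sum V W p -> rep_sum U T p := fun v => (f p v.1, g p v.2).
Let dL p : linear (@d p).
Proof. by move=> a [u u'] [v v']; congr pair; rewrite /= linearP. Qed.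
Let dN p q a (h : arrow p q a) v :
  rep_map (rep_sum U T) h (d v) = d (rep_map (rep_sum V W) h v).
Proof. by case: v => v v'; congr pair; rewrite /= rh_nat. Qed.
Definition rh_diag : rep_hom (rep_sum V W) (rep_sum U T) := rh_make dL dN.
Lemma rh_diagE p v : rh_diag p v = (f p v.1, g p v.2). Proof. by []. Qed.
End Diag.

Section Swap.
Variables V W : rep.
Let s p : rep_sum V W p -> rep_sum W V p := fun v => (v.2, v.1).
Let sL p : linear (@s p). Proof. by move=> a [u u'] [v v']. Qed.
Let sN p q a (h : arrow p q a) v :
  rep_map (rep_sum W V) h (s v) = s (rep_map (rep_sum V W) h v).
Proof. by []. Qed.
Definition rh_swap : rep_hom (rep_sum V W) (rep_sum W V) := rh_make sL sN.
Lemma rh_swapE p v : rh_swap p v = (v.2, v.1). Proof. by []. Qed.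
End Swap.

Lemma slide_eq p q a b (h : arrow q p a) (h' : arrow q p b) : a = b -> slide h = slide h'.
Proof. by move=> e; subst b; rewrite (bool_irrelevance h h'). Qed.

Lemma slide_compE p q r a b c (h : arrow q p a) (h' : arrow r q b) (h'' : arrow r p c) z v :
  c = a + b -> slide h' z (slide h z v) = slide h'' z v.
Proof. by move=> e; rewrite -(slide_comp t h h' h'' e). Qed.

Lemma slide_turnE p (h : arrow p p tau) z v : slide h z v = t *: v.
Proof. by rewrite slide_turn. Qed.

Lemma slide_turns p q a b n (h : arrow q p a) (h' : arrow q p b) :
  b = a + tau * n%:R -> slide h' = t ^+ n *: slide h.
Proof.
move=> e; apply: (hom_P_eq); rewrite rh_ZE !slide1 -(rep_mapX (arrow_turns p n)).
by rewrite (rep_map_comp _ _ h') // addrC.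
Qed.

Lemma arrow_back p q : arrow p q (tau - ang (q - p)).
Proof.
apply: arrow_add; first by rewrite subr_ge0 ltW // ang_lt.
by rewrite clsB cls_tau angK sub0r opprB addrC subrK.
Qed.

Definition there p q : rep_hom (P_ p) (P_ q) := slide (arrow_ang q p).
Definition back p q : rep_hom (P_ q) (P_ p) := slide (arrow_back p q).

Lemma back_there p q z v : back p q z (there p q z v) = t *: v.
Proof. by rewrite (slide_compE _ _ (arrow_turn p)) ?slide_turnE // addrC subrK. Qed.
Lemma there_back p q z v : there p q z (back p q z v) = t *: v.
Proof. by rewrite (slide_compE _ _ (arrow_turn q)) ?slide_turnE // subrK. Qed.

Definition cell_d p q := rh_comp (rh_swap (P_ q) (P_ p)) (rh_diag (there p q) (back p q)).

Lemma cell_dE p q z v : cell_d p q z v = (back p q z v.2, there p q z v.1).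
Proof. by []. Qed.

Lemma cell_dd p q : rh_comp (cell_d p q) (cell_d p q) = t *: rh_id (rep_sum (P_ p) (P_ q)).
Proof.
apply: rep_homP => z [v w]; rewrite rh_compE !cell_dE.
by congr pair; [exact: back_there | exact: there_back].
Qed.

(** The distances of [there] and [back] sum to one full turn, whence
    [d ^ 2 = t]; for [p = q] the first is [0] and the cell is a double of [P_[p]]. *)
Definition cell p q : frob :=
  Frob (fin_gen_sum (fin_gen_P t p) (fin_gen_P t q))
    (projective_sum (@projective_P _ _ t p) (@projective_P _ _ t q)) (cell_dd p q).

Lemma cell_frE p q z v : fr_d (cell p q) z v = (back p q z v.2, there p q z v.1).
Proof. by []. Qed.

(** Only the square for [there] has to be tested: the one for [back] follows
    because both composites of [there] and [back] are multiplication by [t],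
    and [there] is injective. *)
Lemma diag_comm p q p' q' (f : rep_hom (P_ p) (P_ p')) (g : rep_hom (P_ q) (P_ q')) :
    rh_comp g (there p q) = rh_comp (there p' q') f ->
  forall z v, rh_diag f g z (fr_d (cell p q) z v) = fr_d (cell p' q') z (rh_diag f g z v).
Proof.
move=> e z v.
have e' z' v' : g z' (there p q z' v') = there p' q' z' (f z' v').
  exact: (rep_hom_eq (p := z') v' e).
rewrite cell_frE rh_diagE [RHS]cell_frE; congr pair; last exact: e'.
apply: (slide_mono t0 (h := arrow_ang q' p')).
rewrite -/(there p' q') there_back -e' there_back.
exact: linearZ.
Qed.

Section Shift.
Variables (p q p' q' : S1) (a b : RR) (ha : arrow p' p a) (hb : arrow q' q b).
Hypothesis ab : a + ang (q' - p') = ang (q - p) + b.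
Let comm : rh_comp (slide hb) (there p q) = rh_comp (there p' q') (slide ha).
Proof.
have h : arrow q' p (a + ang (q' - p')).
  by apply: arrow_comp (arrow_ang q' p') ha _.
by rewrite (slide_comp _ _ _ h) // (slide_comp _ _ _ h).
Qed.
Definition shift : frob_hom (cell p q) (cell p' q') := 
  @fh_make _ _ _ (cell p q) (cell p' q') (rh_diag (slide ha) (slide hb)) (diag_comm comm).
Lemma shiftE z v : shift z v = (slide ha z v.1, slide hb z v.2). Proof. by []. Qed.

(** The homotopy sends the second generator of the source to a multiple of the
    first generator of the target. *)
Lemma shift_null_fst : ang (q - p) <= a -> null_homotopic shift.
Proof.
move=> la; have h : arrow p' q (a - ang (q - p)).
  apply: arrow_add; first by rewrite subr_ge0.
  by rewrite clsB angK opprB addrCA [q + _]addrC subrK (arrowE ha) addrC subrK.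
exists (rh_comp (rh_inl (P_ p') (P_ q')) (rh_comp (slide h) (rh_snd (P_ p) (P_ q)))).
move=> z v; rewrite shiftE.
rewrite -[RHS]/(slide h z (there p q z v.1) + back p' q' z 0,
  0 + there p' q' z (slide h z v.2)) linear0 addr0 add0r.
congr pair; first by rewrite (slide_compE _ _ ha) // addrC subrK.
by rewrite (slide_compE _ _ hb) //; have := ab; lra.
Qed.

Lemma shift_null_snd : tau - ang (q - p) <= b -> null_homotopic shift.
Proof.
move=> lb; have h : arrow q' p (b - (tau - ang (q - p))).
  apply: arrow_add; first by rewrite subr_ge0.
  rewrite [cls (b - _)]clsB [cls (tau - _)]clsB angK cls_tau sub0r opprK.
  by rewrite addrCA [p + _]addrC subrK (arrowE hb) addrC subrK.
exists (rh_comp (rh_inr (P_ p') (P_ q')) (rh_comp (slide h) (rh_fst (P_ p) (P_ q)))).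
move=> z v; rewrite shiftE.
rewrite -[RHS]/(0 + back p' q' z (slide h z v.1),
  slide h z (back p q z v.2) + there p' q' z 0) linear0 addr0 add0r.
congr pair; first by rewrite (slide_compE _ _ ha) //; have := ab; lra.
by rewrite (slide_compE _ _ hb) // addrC subrK.
Qed.

End Shift.

Lemma shift_comp p q p' q' p'' q'' a b a' b' a'' b''
    (ha : arrow p' p a) (hb : arrow q' q b)
    (ha' : arrow p'' p' a') (hb' : arrow q'' q' b')
    (ha'' : arrow p'' p a'') (hb'' : arrow q'' q b'') e e' e'' :
  a'' = a + a' -> b'' = b + b' ->
  fh_comp (shift ha' hb' e') (shift ha hb e) =
  shift ha'' hb'' e''.
Proof.
move=> ea eb; apply: frob_homP => z v; rewrite fh_compE !shiftE.
by congr pair; apply: slide_compE.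
Qed.

Lemma cell_t_null p q : null_homotopic (t *: fh_id (cell p q)).
Proof.
exists (rh_comp (rh_inl (P_ p) (P_ q)) (rh_comp (back p q) (rh_snd (P_ p) (P_ q)))).
move=> z [v w].
rewrite -[RHS]/(back p q z (there p q z v) + back p q z 0,
  0 + there p q z (back p q z w)) linear0 addr0 add0r.
by rewrite back_there there_back.
Qed.

Lemma cell_diag_null p : null_homotopic (fh_id (cell p p)).
Proof.
have e : 0 + ang (p - p) = ang (p - p) + 0 by rewrite addrC.
have -> : fh_id (cell p p) = shift (arrow_id p) (arrow_id p) e.
  by apply: frob_homP => z [v w]; rewrite shiftE !slide_id.
by apply: shift_null_fst; rewrite subrr ang0.
Qed.

(** Both components are scalars times the shortest slides. Commutation makes
    one scalar a power of [t] times the other; this power is turned into extra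
    turns of the slide of the first. *)
Lemma diag_shift p q p' q' (f : rep_hom (P_ p) (P_ p')) (g : rep_hom (P_ q) (P_ q')) :
    rh_comp g (there p q) = rh_comp (there p' q') f ->
  exists c a b (ha : arrow p' p a) (hb : arrow q' q b),
  [/\ a + ang (q' - p') = ang (q - p) + b, f = c *: slide ha & g = c *: slide hb].
Proof.
move=> e; have := hom_PP f; have := hom_PP g.
move: (f p (1 : R)) (g q (1 : R)) => c c' gE fE.
pose a := ang (p' - p); pose b := ang (q' - q).
have ha : arrow q' p (a + ang (q' - p')).
  exact: arrow_comp (arrow_ang q' p') (arrow_ang p' p) _.
have hb : arrow q' p (ang (q - p) + b).
  by apply: arrow_comp (arrow_ang q' q) (arrow_ang q p) _.
have := arrow_angE ha; set m := wind _ _ _ => mE.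
have := arrow_angE hb; set n := wind _ _ _ => nE.
have cc : c * t ^+ m = c' * t ^+ n.
  have ua := slide_turns (arrow_ang q' p) ha mE.
  have ub := slide_turns (arrow_ang q' p) hb nE.
  have e1 : c' *: slide (arrow_ang q' q) p (slide (arrow_ang q p) p (1 : R)) =
            c *: slide (arrow_ang q' p') p (slide (arrow_ang p' p) p (1 : R)).
    have := @rep_hom_eq _ _ _ (P_ p) (P_ q') _ _ p (1 : R) e; rewrite gE fE => h.
    by apply: etrans h _; apply: (linearZ_LR (there p' q' p)).
  move: e1; rewrite (slide_compE _ _ hb) // (slide_compE _ _ ha) // ua ub !rh_ZE !slide1.
  rewrite !P_mapE wind_ang expr0 !mulr1 => e1; symmetry.
  by rewrite -[t ^+ n]mulr1 -[t ^+ m]mulr1.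
have shiftn x y k : arrow x y (ang (x - y) + tau * k%:R).
  by apply: arrow_comp (arrow_turns x k) (arrow_ang x y) _.
have eqE : a + ang (q' - p') + tau * n%:R = ang (q - p) + b + tau * m%:R.
  rewrite mE nE; lra.
have [mn|nm] := leqP m n.
  have cE : c = c' * t ^+ (n - m).
    by apply: (mulIf (expf_neq0 m t0)); rewrite cc -mulrA -exprD subnK.
  exists c', (a + tau * (n - m)%:R), b, (shiftn _ _ _), (arrow_ang _ _); split=> //.
    by rewrite natrB // mulrBr; lra.
  by rewrite fE cE -scalerA; congr (_ *: _); apply: esym (slide_turns _ _ _).
have cE : c' = c * t ^+ (m - n).
  by apply: (mulIf (expf_neq0 n t0)); rewrite -cc -mulrA -exprD subnK // ltnW.
exists c, a, (b + tau * (m - n)%:R), (arrow_ang _ _), (shiftn _ _ _); split=> //.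
  by rewrite natrB ?(ltnW nm) // mulrBr; lra.
by rewrite gE cE -scalerA; congr (_ *: _); apply: esym (slide_turns _ _ _).
Qed.

(** A path from [p] to [r] that is longer than the shortest one contains a full
    turn, which contributes a factor [t]. *)
Lemma comp_slide_radical p q r b (h : arrow q p b) (k : rep_hom (P_ q) (P_ r)) :
  ang (r - p) < b -> exists c, k p (slide h p (1 : R)) = c * t :> R.
Proof.
move=> hb; rewrite (hom_PP k) rh_ZE; set c : R := k q _.
have h' : arrow r p (b + ang (r - q)) by apply: arrow_comp (arrow_ang r q) h _.
rewrite (slide_compE _ _ h') // slide1 P_mapE mulr1.
have := arrow_angE h'; case: (wind _ _ _) => [|n] nE.
  by have := ang_ge0 (r - q); lra.
by exists (c * t ^+ n); rewrite exprSr -[LHS]/(c * (t ^+ n * t)) mulrA.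
Qed.

Lemma slide_comp_radical p q r b (h : arrow r q b) (k : rep_hom (P_ p) (P_ q)) :
  ang (r - p) < b -> exists c, slide h p (k p (1 : R)) = c * t :> R.
Proof.
move=> hb; rewrite (hom_PP k) rh_ZE; set c : R := k p _.
have h' : arrow r p (ang (q - p) + b) by apply: arrow_comp h (arrow_ang q p) _.
rewrite linearZ /= (slide_compE _ _ h') // slide1 P_mapE mulr1.
have := arrow_angE h'; case: (wind _ _ _) => [|n] nE.
  by have := ang_ge0 (q - p); lra.
by exists (c * t ^+ n); rewrite exprSr -[LHS]/(c * (t ^+ n * t)) mulrA.
Qed.

(** In the first coefficient of [h d + d h], both terms come from paths between
    the first points that are longer than [a], which is the shortest. *)
Lemma shift_not_null p q p' q' a b (ha : arrow p' p a) (hb : arrow q' q b) ab c :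
    a < ang (q - p) -> b < tau - ang (q - p) ->
    null_homotopic (c *: shift ha hb ab) ->
  exists x : R, c = x * t.
Proof.
move=> la lb [h hE].
have aE : ang (p' - p) = a.
  by apply: ang_arrow => //; have := ang_lt (q - p); lra.
have := congr1 fst (hE p ((1 : R), 0)); rewrite fh_ZE shiftE !cell_frE.
pose k1 := rh_comp (rh_fst (P_ p') (P_ q')) (rh_comp h (rh_inr (P_ p) (P_ q))).
pose k2 := rh_comp (rh_snd (P_ p') (P_ q')) (rh_comp h (rh_inl (P_ p) (P_ q))).
have e0 : back p q p (0 : R) = 0 := linear0 (back p q p).
rewrite -[RHS]/((h p (back p q p (0 : R), there p q p (1 : R))).1 +
  back p' q' p (k2 p (1 : R))) e0.
rewrite -[RHS]/(k1 p (there p q p (1 : R)) + back p' q' p (k2 p (1 : R))).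
have [|x ->] := @comp_slide_radical p q p' _ (arrow_ang q p) k1; first by rewrite aE.
have [|y ->] := @slide_comp_radical p q' p' _ (arrow_back p' q') k2.
  by rewrite aE; lra.
rewrite -[LHS]/(c * (slide ha p (1 : R) : R)) slide1.
rewrite P_mapE -aE wind_ang expr0 !mulr1 => ->.
by exists (x + y); rewrite [RHS]mulrDl.
Qed.

Lemma swap_comm p q : p != q -> forall z v,
  rh_swap (P_ p) (P_ q) z (fr_d (cell p q) z v) =
  fr_d (cell q p) z (rh_swap (P_ p) (P_ q) z v).
Proof.
move=> pq z v; rewrite cell_frE rh_swapE [RHS]cell_frE.
have e : ang (p - q) = tau - ang (q - p).
  by rewrite -opprB angN // subr_eq0 eq_sym.
by congr pair; [rewrite /there (slide_eq _ (arrow_back q p)) // e opprB addrCA subrr addr0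
  | rewrite /back (slide_eq _ (arrow_ang p q)) // e].
Qed.

Definition cell_swap p q (pq : p != q) : frob_hom (cell p q) (cell q p) :=
  @fh_make _ _ _ (cell p q) (cell q p) (rh_swap (P_ p) (P_ q)) (swap_comm pq).

Lemma cell_swapE p q (pq : p != q) z v : cell_swap pq z v = (v.2, v.1).
Proof. by []. Qed.

End Cells.

(** * Splitting off a cell *)

Lemma exists_minimizer (RR : realType) (I : finType) (P : I -> Prop) (N : I -> RR) :
  (exists i, P i) -> exists i, P i /\ forall j, P j -> N i <= N j.
Proof.
case=> i0 /asboolP Pi0; case: (@Order.TotalTheory.arg_minP _ _ I i0 (fun i => `[< P i >]) N Pi0).
move=> i /asboolP Pi Pmin; exists i; split=> // j Pj.
by apply: Pmin; apply/asboolP.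
Qed.

Section Split.
Variables (RR : realType) (R : idomainType) (t : R).
Hypotheses (R_dvr : is_dvr R) (t_unif : uniformizer t).
Let t0 : t != 0 := uniformizer_neq0 R_dvr t_unif.
Local Notation S1 := (circle RR).
Local Notation tau := (tau RR).
Local Notation rep := (rep RR t).
Local Notation P_ := (P_ t).
Local Notation frob := (frob RR t).
Implicit Types (p q r z : S1).

Definition lifts (V : rep) q (u : V q) (a : RR) : Prop :=
  exists p (h : arrow p q a) (u' : V p), rep_map V h u' = u.

Lemma lifts_le (V : rep) q (u : V q) a b : lifts u a -> 0 <= b -> b <= a -> lifts u b.
Proof.
case=> p [h [u' <-]] b0 ba.
have h1 : arrow p (q + cls b) (a - b).
  apply: arrow_add; first by rewrite subr_ge0.
  by rewrite (arrowE h) clsB addrA addrAC addrK subrK.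
have h2 : arrow (q + cls b) q b by apply: arrow_add.
exists (q + cls b), h2, (rep_map V h1 u').
by apply: rep_map_comp; rewrite addrC subrK.
Qed.

Lemma lifts_rep_map (V : rep) q r (u : V q) a b (h : arrow q r b) :
  lifts u a -> lifts (rep_map V h u) (a + b).
Proof.
case=> p [k [u' <-]]; have hk : arrow p r (a + b).
  by apply: arrow_comp k h _; rewrite addrC.
by exists p, hk, u'; rewrite (rep_map_comp k h hk) // addrC.
Qed.

Section MaximalLift.
Variables (V : rep) (I : finType) (x : I -> S1).
Variables (i : rep_hom V (rep_dsum (fun k => P_ (x k)))).
Variables (g : rep_hom (rep_dsum (fun k => P_ (x k))) V).
Hypothesis gi : rh_comp g i = rh_id V.

(** A nonzero [u] lifts exactly as far as the smallest of the distances
    [ang (x k - q) + tau * valuation c_k], [c_k] running over its nonzero coordinates;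
    at the end of that lift the coordinate realising the minimum is a unit. *)
Lemma maximal_lift q (u : V q) : u != 0 ->
  exists k a (h : arrow (x k) q a) (u' : V (x k)),
    rep_map V h u' = u /\ (i (x k) u' k : R) \is a GRing.unit.
Proof.
move=> u0; have gi' z v : g z (i z v) = v by apply: (rep_hom_eq v gi).
pose c k : R := i q u k.
have [k ck] : exists k, c k != 0.
  apply: contrapT => h; case/eqP: u0; rewrite -[u]gi' -[RHS](linear0 (g q)).
  congr (g q _); apply: dsumP => k; apply/eqP; apply: contrapT => /negP ck.
  by apply: h; exists k.
pose N k := ang (x k - q) + tau * (valuation t (c k))%:R.
have [k0 [c0 Nmin]] := @exists_minimizer RR I (fun k => c k != 0) N (ex_intro _ k ck).
have h : arrow (x k0) q (N k0).
  by apply: arrow_comp (arrow_turns (x k0) (valuation t (c k0))) (arrow_ang _ _) _.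
have dv k1 : exists x0 : R, c k1 = t ^+ wind (x k1) (x k0) (N k0) * x0.
  have [->|ck1] := eqVneq (c k1) 0; first by exists 0; rewrite mulr0.
  apply/(expr_dvdE R_dvr t_unif) => //; rewrite -ltnS -(@ltr_nat RR).
  rewrite -(ltr_pM2l (tau_gt0 RR)) -natr1 mulrDr mulr1.
  have := windE (x k1) h; have := Nmin _ ck1; rewrite /N.
  by have := ang_lt (x k1 - x k0); lra.
have [r rE] := choose_family dv.
exists k0, (N k0), h, (g (x k0) r).
have e : rep_map V h (g (x k0) r) = u.
  rewrite rh_nat -[RHS]gi'; congr (g q _); apply: dsumP => k1; exact: esym (rE k1).
split=> //; have [w wU wE] := valuationP R_dvr t_unif c0.
have := congr1 (fun v => i q v k0) e.
rewrite -rh_nat -[RHS]/(c k0) wE.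
rewrite -[LHS]/(t ^+ wind (x k0) (x k0) (N k0) * (i (x k0) (g (x k0) r) k0 : R)).
have -> : wind (x k0) (x k0) (N k0) = valuation t (c k0).
  apply/eqP; rewrite -(@eqr_nat RR); apply/eqP; apply: (mulfI (tau_neq0 RR)).
  by have := arrow_angE h; rewrite {1}/N => /addrI /esym.
by move=> /(mulfI (expf_neq0 _ t0)) ->.
Qed.
End MaximalLift.

Section Idempotent.
Variables (V : frob) (e : frob_hom V V).
Hypotheses (ee : fh_comp e e = e) (e0 : e != 0).

Let eE p v : e p (e p v) = e p v.
Proof. by rewrite -fh_compE ee. Qed.

Let inj p q a (h : arrow p q a) : injective (rep_map V h).
Proof. exact: (rep_map_inj t0 (fr_fg V) (@fr_proj _ _ _ V)). Qed.

Let tinj p : injective (fun v : V p => t *: v).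
Proof. exact: (scale_t_inj t0 (fr_fg V) (@fr_proj _ _ _ V)). Qed.

Let dinj p (v : V p) : v != 0 -> fr_d V p v != 0.
Proof.
apply: contra_neq => dv; apply: (@tinj p); rewrite /= -frob_dd dv.
by rewrite linear0 scaler0.
Qed.

Let efix p q a (h : arrow p q a) v : e q (rep_map V h v) = rep_map V h v -> e p v = v.
Proof. by rewrite -rh_nat => /inj. Qed.

(** Among the pairs [(k, l)] such that some [v] at [x k] has [d v] equal to the
    image, along the shortest arrow, of a [w] at [x l] whose coordinate [l] is a
    unit, take one with the shortest arrow. Then [d u] lifts at least that far
    for every [u] in the image of [e]: lift [u] and the differential of its lift
    as far as possible, and compare with the minimum. *)
Lemma shortest_differential :
  exists p q (v : V p) (w : V q) (phi : rep_hom V (P_ q)),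
  [/\ e p v = v, e q w = w, phi q w = 1 :> R,
      fr_d V p v = rep_map V (arrow_ang q p) w
    & forall z (u : V z), e z u = u -> lifts (fr_d V z u) (ang (q - p))].
Proof.
have [I [x [i [g gi]]]] := projective_retract (fr_fg V) (@fr_proj _ _ _ V).
pose N (kl : I * I) := ang (x kl.2 - x kl.1).
pose P (kl : I * I) := exists (v : V (x kl.1)) (w : V (x kl.2)),
  [/\ e _ v = v, e _ w = w, (i (x kl.2) w kl.2 : R) \is a GRing.unit
    & fr_d V _ v = rep_map V (arrow_ang _ _) w].
have step z (u : V z) : u != 0 -> e z u = u ->
    exists k b (h : arrow (x k) z b) u', [/\ u = rep_map V h u', e _ u' = u',
      (i (x k) u' k : R) \is a GRing.unit & u' != 0].
  move=> u0 eu; have [k [b [h [u' [uE u'U]]]]] := maximal_lift gi u0.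
  exists k, b, h, u'; split=> //; first by apply: (@efix _ _ _ h); rewrite uE.
  by apply: contra_neq u0 => u'0; rewrite -uE u'0 linear0.
have long k (u : V (x k)) l b (h : arrow (x l) (x k) b) w :
    e _ u = u -> e _ w = w -> (i _ u k : R) \is a GRing.unit ->
    (i _ w l : R) \is a GRing.unit ->
    fr_d V _ u = rep_map V h w -> P (k, l) \/ tau <= b.
  move=> eu ew uU wU du; have := arrow_angE h; case: (wind _ _ _) => [|n] bE.
    left; exists u, w; split=> //; rewrite du; apply: rep_map_eq.
    by rewrite bE mulr0 addr0.
  right; rewrite bE -natr1 mulrDr mulr1; have := ang_ge0 (x l - x k).
  by have : 0 <= tau * n%:R; [rewrite mulr_ge0 ?(ltW (tau_gt0 RR))|lra].
have exP : exists kl, P kl.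
  have [z [u u0]] : exists z (u : V z), e z u != 0.
    apply: contrapT => h; case/eqP: e0; apply: frob_homP => z u.
    by apply: contrapT => /eqP eu; apply: h; exists z, u.
  have [k [b [h [u' [_ eu' u'U u'0]]]]] := step _ _ u0 (eE u).
  have edu' : e _ (fr_d V _ u') = fr_d V _ u' by rewrite frob_homC eu'.
  have [l [b' [h' [w [dE ew wU _]]]]] := step _ _ (dinj u'0) edu'.
  have [|lb] := long _ _ _ _ _ _ eu' ew u'U wU dE; first by exists (k, l).
  (* Otherwise [d u'] lifts by a full turn, so that [u'] is itself in the image
     of [d], and the pair of that preimage and [u'] is at distance [0]. *)
  have [|r [hr [y yE]]] := @lifts_le V (x k) (fr_d V _ u') _ tau _ (ltW (tau_gt0 RR)) lb.
    by exists (x l), h', w.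
  have rk : r = x k by rewrite (arrowE hr) cls_tau subr0.
  move: hr y yE; rewrite rk => hr y; rewrite rep_map_turn -frob_dd => yE.
  have {}yE : fr_d V _ y = u'.
    apply: (@tinj (x k)); rewrite /= -!frob_dd; congr (fr_d V _ _); exact: yE.
  exists (k, k), (e _ y), u'; split=> //.
  rewrite -frob_homC yE eu' (rep_map_eq _ (arrow_id _)) ?rep_map_id //.
  by rewrite subrr ang0.
have [[k l] [[v [w [ev ew wU dv]]] Nmin]] := exists_minimizer N exP.
pose pr : rep_hom (rep_dsum (fun k => P_ (x k))) (P_ (x l)) :=
  @rh_make _ _ _ (rep_dsum (fun k => P_ (x k))) (P_ (x l)) (fun _ v => v l)
    (fun _ _ _ _ => erefl) (fun _ _ _ _ _ => erefl).
exists (x k), (x l), v, w, ((i (x l) w l : R)^-1 *: rh_comp pr i).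
split=> //; first by rewrite rh_ZE rh_compE; apply: (mulVr wU).
move=> z u eu; have nn := ang_ge0 (x l - x k).
have [->|u0] := eqVneq u 0.
  have h : arrow (z + cls (ang (x l - x k))) z (ang (x l - x k)) by apply: arrow_add.
  by exists _, h, 0; rewrite !linear0.
have [k' [b [h [u' [uE eu' u'U u'0]]]]] := step _ _ u0 eu.
have edu' : e _ (fr_d V _ u') = fr_d V _ u' by rewrite frob_homC eu'.
have [l' [b' [h' [w' [dE ew' w'U _]]]]] := step _ _ (dinj u'0) edu'.
have lb : ang (x l - x k) <= b'.
  have [Pkl|] := long _ _ _ _ _ _ eu' ew' u'U w'U dE; last first.
    by have := ang_lt (x l - x k); lra.
  apply: le_trans (Nmin _ Pkl) _; rewrite /N /= (arrow_angE h') lerDl.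
  by rewrite mulr_ge0 // (ltW (tau_gt0 RR)).
apply: (@lifts_le _ _ _ (b' + b)) => //; last by have := arrow_ge0 h; lra.
by rewrite uE -rh_nat; apply: lifts_rep_map; exists (x l'), h', w'.
Qed.

End Idempotent.
End Split.

Section SplitCell.
Variables (RR : realType) (R : idomainType) (t : R).
Hypotheses (R_dvr : is_dvr R) (t_unif : uniformizer t).
Let t0 : t != 0 := uniformizer_neq0 R_dvr t_unif.
Local Notation S1 := (circle RR).
Local Notation tau := (tau RR).
Local Notation rep := (rep RR t).
Local Notation P_ := (P_ t).
Local Notation frob := (frob RR t).
Local Notation cell := (cell t).
Implicit Types (p q r z : S1).

(** The second generator of a cell is determined by the first, because the
    differential of the first is a shift of it and shifts are injective. *)
Lemma cell_hom_eq p q (Y : frob) (F G : frob_hom (cell p q) Y) :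
  F p ((1 : R), 0) = G p ((1 : R), 0) -> F = G.
Proof.
move=> e; have el : rh_comp F (rh_inl (P_ p) (P_ q)) = rh_comp G (rh_inl (P_ p) (P_ q)).
  exact: hom_P_eq.
have er : rh_comp F (rh_inr (P_ p) (P_ q)) = rh_comp G (rh_inr (P_ p) (P_ q)).
  apply: hom_P_eq; rewrite !rh_compE.
  apply: (rep_map_inj t0 (h := arrow_ang q p) (fr_fg Y) (@fr_proj _ _ _ Y)).
  rewrite [LHS]rh_nat [RHS]rh_nat.
  have -> : rep_map (cell p q) (arrow_ang q p) (rh_inr (P_ p) (P_ q) q (1 : R)) =
      fr_d (cell p q) p ((1 : R), 0).
    rewrite cell_frE /there slide1; congr pair.
    by rewrite [LHS]linear0 -[RHS]/(back t p q p 0) linear0.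
  by rewrite !frob_homC e.
apply: frob_homP => z [a b].
have -> : (a, b) = rh_inl (P_ p) (P_ q) z a + rh_inr (P_ p) (P_ q) z b.
  by congr pair; rewrite ?addr0 ?add0r.
rewrite !linearD; congr (_ + _).
  exact: (rep_hom_eq a el).
exact: (rep_hom_eq b er).
Qed.

Variables (V : frob) (e : frob_hom V V).
Hypotheses (ee : fh_comp e e = e) (e0 : e != 0).

Let eE p v : e p (e p v) = e p v.
Proof. by rewrite -fh_compE ee. Qed.

(** The cell is spanned by [v] and [w] of the shortest differential. The
    retraction is [u |-> (psi u, phi u)] with [psi] the lift of [phi \o d]; on
    the cell it is [1 + c d], with inverse [1 - c d] up to the unit
    [1 - c ^ 2 t]. *)
Lemma split_cell : exists p q (s : frob_hom (cell p q) V) (r : frob_hom V (cell p q)),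
  [/\ fh_comp r s = fh_id (cell p q), fh_comp e s = s & fh_comp r e = r].
Proof.
have [p [q [v [w [phi0 [ev ew phi0w dv dlift]]]]]] :=
  shortest_differential R_dvr t_unif ee e0.
pose there := there t p q; pose back := back t p q; pose hd := arrow_ang q p.
have thereI := slide_mono t0 (h := hd).
pose phi := rh_comp phi0 e.
have phiE z u : phi z u = phi0 z (e z u) by [].
have phie z u : phi z (e z u) = phi z u by rewrite !phiE eE.
have phiw : phi q w = 1 :> R by rewrite phiE ew.
have [|psi psiE] := @factor_mono _ _ t V (P_ p) (P_ q) there (rh_comp phi (fr_d V)) thereI.
  move=> z u; rewrite rh_compE phiE frob_homC.
  have [r [h [y <-]]] := dlift z (e z u) (eE u).
  exists (phi0 r y); rewrite -rh_nat P_mapE slideE; congr (t ^+ _ * _).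
  rewrite /wind (arrowE h) angK; do 4!f_equal.
  by rewrite opprB addrA [p + _]addrC subrK.
have {}psiE z u : there z (psi z u) = phi z (fr_d V z u) by apply: (rep_hom_eq u psiE).
have psie z u : psi z (e z u) = psi z u.
  by apply: (thereI z); rewrite -/there !psiE -frob_homC phie.
pose yv := yoneda v; pose yw := yoneda w.
have yvw : rh_comp (fr_d V) yv = rh_comp yw there.
  apply: hom_P_eq; rewrite !rh_compE yoneda1 dv [there _ _]slide1 -rh_nat.
  by congr (rep_map V _ _); rewrite yoneda1.
have inj p' q' a (h : arrow p' q' a) : injective (rep_map V h).
  exact: (rep_map_inj t0 (fr_fg V) (@fr_proj _ _ _ V)).
have ywv : rh_comp (fr_d V) yw = rh_comp yv back.
  apply: hom_P_eq; rewrite !rh_compE yoneda1 [back _ _]slide1 -rh_nat.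
  have -> : yv p (1 : R) = v by apply: yoneda1.
  apply: (inj _ _ _ hd); rewrite rh_nat -dv frob_dd.
  by rewrite (rep_map_comp _ _ (arrow_turn p)) ?rep_map_turn // addrC subrK.
pose s0 := rh_comp yv (rh_fst (P_ p) (P_ q)) + rh_comp yw (rh_snd (P_ p) (P_ q)).
have sE z a b : s0 z (a, b) = yv z a + yw z b by [].
have sC z u : s0 z (fr_d (cell p q) z u) = fr_d V z (s0 z u).
  case: u => a b; rewrite cell_frE !sE linearD addrC; congr (_ + _).
    exact: esym (rep_hom_eq a yvw).
  exact: esym (rep_hom_eq b ywv).
pose s := @fh_make _ _ _ (cell p q) V s0 sC.
pose r0 := rh_comp (rh_inl (P_ p) (P_ q)) psi + rh_comp (rh_inr (P_ p) (P_ q)) phi.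
have rE z u : r0 z u = (psi z u, phi z u).
  by rewrite rh_DE; congr pair; rewrite ?addr0 ?add0r.
have rC z u : r0 z (fr_d V z u) = fr_d (cell p q) z (r0 z u).
  rewrite !rE cell_frE; congr pair; last by rewrite -psiE.
  apply: (thereI z); rewrite -/there psiE frob_dd.
  apply: etrans (linearZ_LR (phi z) t u) _.
  by symmetry; apply: there_back.
pose r := @fh_make _ _ _ V (cell p q) r0 rC.
pose c : R := phi p v.
pose d := @fh_make _ _ _ (cell p q) (cell p q) (fr_d (cell p q)) (fun _ _ => erefl).
have rs : fh_comp r s = fh_id (cell p q) + c *: d.
  apply: cell_hom_eq; rewrite fh_compE.
  have -> : s p ((1 : R), 0) = v.
    by rewrite -[LHS]/(yv p (1 : R) + yw p 0) linear0 addr0 yoneda1.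
  rewrite -[LHS]/(r0 p v) rE; congr pair.
    apply: (thereI p); rewrite -/there psiE dv -rh_nat phiw.
    rewrite -[X in there p X]/((1 : R) + c *: back p (0 : R)) linear0 scaler0 addr0.
    exact: esym (slide1 t hd).
  rewrite -[RHS]/(0 + c *: there p (1 : R)) add0r [there p _]slide1 P_mapE wind_ang.
  by rewrite expr0 mul1r; exact: esym (mulr1 c).
have uU := unit_1_sub R_dvr t_unif (c * c); set u := 1 - _ in uU.
exists p, q, s, (u^-1 *: (r - c *: fh_comp d r)); split.
- apply: frob_homP => z x.
  have rsE : r z (s z x) = x + c *: fr_d (cell p q) z x.
    by rewrite -[LHS]/(fh_comp r s z x) rs.
  rewrite -[LHS]/(u^-1 *: (r z (s z x) - c *: fr_d (cell p q) z (r z (s z x)))).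
  have dE : fr_d (cell p q) z (x + c *: fr_d (cell p q) z x) =
      fr_d (cell p q) z x + (c * t) *: x.
    apply: etrans (linearD (fr_d (cell p q) z) _ _) _; congr (_ + _).
    by apply: etrans (linearZ_LR (fr_d (cell p q) z) _ _) _; rewrite frob_dd scalerA.
  rewrite rsE dE [c *: (_ + _)]scalerDr opprD addrA addrK scalerA mulrA.
  by rewrite -{1}[x]scale1r -scalerBl -/u scalerA mulVr // scale1r.
- apply: cell_hom_eq; rewrite fh_compE.
  have -> : s p ((1 : R), 0) = v; last exact: ev.
  by rewrite -[LHS]/(yv p (1 : R) + yw p 0) linear0 addr0 yoneda1.
- apply: frob_homP => z x.
  have re : r z (e z x) = r z x by rewrite -![r z _]/(r0 z _) !rE psie phie.
  rewrite -[LHS]/(u^-1 *: (r z (e z x) - c *: fr_d (cell p q) z (r z (e z x)))).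
  by rewrite re.
Qed.

End SplitCell.

(** * Decomposition into cells *)

Section FrobeniusCategory.
Variables (RR : realType) (R : idomainType) (t : R).
Local Notation frob := (frob RR t).

Let frob_linl (X Y Z : frob) (f : frob_hom X Y) :
  linear (fun g : frob_hom Y Z => fh_comp g f).
Proof. by move=> a g h; apply: frob_homP. Qed.
Let frob_linr (X Y Z : frob) (g : frob_hom Y Z) :
  linear (fun f : frob_hom X Y => fh_comp g f).
Proof.
move=> a f h; apply: frob_homP => p v.
by rewrite !(fh_compE, fh_DE, fh_ZE) linearP.
Qed.
Let frob_compA (X Y Z W : frob) (h : frob_hom Z W) (g : frob_hom Y Z)
  (f : frob_hom X Y) : fh_comp h (fh_comp g f) = fh_comp (fh_comp h g) f.
Proof. exact: frob_homP. Qed.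
Let frob_comp1m (X Y : frob) (f : frob_hom X Y) : fh_comp (fh_id Y) f = f.
Proof. exact: frob_homP. Qed.
Let frob_compm1 (X Y : frob) (f : frob_hom X Y) : fh_comp f (fh_id X) = f.
Proof. exact: frob_homP. Qed.

Definition frob_cat : lincat R :=
  @LinCat R frob (fun X Y => frob_hom X Y : lmodType R) (@fh_id _ _ _) (@fh_comp _ _ _)
    frob_linl frob_linr frob_compA frob_comp1m frob_compm1.

Definition stabilize : linfunctor frob_cat (stable_cat RR t) :=
  @LinFunctor R frob_cat (stable_cat RR t) id
    (fun X Y => mk_linear (@stable_class_lin _ _ _ X Y)) (fun=> erefl)
    (fun X Y Z g f => esym (stable_compE g f)).

Lemma frob_cat_zero : exists Z : frob_cat, idm Z = 0.
Proof.
exists (frob_zero RR t); apply: frob_homP => p v.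
by apply: functional_extensionality_dep => -[].
Qed.

Lemma frob_cat_sum (X Y : frob_cat) : exists W (i : hom frob_cat X W)
    (j : hom frob_cat Y W) (p : hom frob_cat W X) (q : hom frob_cat W Y),
  [/\ comp p i = idm X, comp q j = idm Y, comp q i = 0, comp p j = 0
    & comp i p + comp j q = idm W].
Proof.
exists (frob_sum X Y), (fh_inl X Y), (fh_inr X Y), (fh_fst X Y), (fh_snd X Y).
split; try exact: frob_homP.
by apply: frob_homP => z [v w]; congr pair; rewrite ?addr0 ?add0r.
Qed.

Lemma frob_biproducts (I : finType) (X : I -> frob_cat) : exists W, is_biproduct X W.
Proof. exact: (finite_biproducts frob_cat_zero frob_cat_sum). Qed.

End FrobeniusCategory.

Section Decomposition.
Variables (RR : realType) (R : idomainType) (t : R) (K : fieldType).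
Hypotheses (R_dvr : is_dvr R) (t_unif : uniformizer t) (red : residue_map t K).
Local Notation S1 := (circle RR).
Local Notation P_ := (P_ t).
Local Notation frob := (frob RR t).
Local Notation frob_cat := (frob_cat RR t).
Local Notation cell := (cell t).

Definition orthonormal (V : frob_cat) (I : finType) (p q : I -> S1)
    (s : forall i, hom frob_cat (cell (p i) (q i)) V)
    (r : forall i, hom frob_cat V (cell (p i) (q i))) : Prop :=
  (forall i, comp (r i) (s i) = idm _) /\
  (forall i j, i != j -> comp (r j) (s i) = 0).

(** At a point of the circle, the first generators of the cells span a free
    summand of [R ^ J]; comparing ranks modulo [t] bounds their number. *)
Lemma orthonormal_card (V : frob_cat) (J : finType) (x : J -> S1)
    (i : rep_hom (V : frob) (rep_dsum (fun k => P_ (x k))))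
    (g : rep_hom (rep_dsum (fun k => P_ (x k))) (V : frob))
    (I : finType) (p q : I -> S1) s r :
  rh_comp g i = rh_id (V : frob) -> @orthonormal V I p q s r -> (#|I| <= #|J|)%N.
Proof.
move=> gi [rs1 rs0]; pose z : S1 := 0.
pose u k : V z := (s k : frob_hom _ _) z ((1 : R), 0).
pose c k (v : V z) : R := ((r k : frob_hom _ _) z v).1.
have cu k l : c l (u k) = (k == l)%:R.
  rewrite -[LHS]/((fh_comp (r l) (s k) z ((1 : R), 0)).1).
  have [<-|kl] := eqVneq k l; first by rewrite [fh_comp _ _]rs1.
  by rewrite [fh_comp _ _]rs0.
pose dl j : rep_dsum (fun k => P_ (x k)) z := fun k => (k == j)%:R : R.
have cL k : linear (c k : V z -> R^o).
  by move=> a v w; rewrite /c linearP.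
have decomp v : v = \sum_j (i z v j : R) *: g z (dl j).
  rewrite -[LHS]/(rh_id (V : frob) z v) -gi rh_compE.
  under eq_bigr do rewrite -linearZ_LR.
  rewrite -linear_sum; congr (g z _); apply: dsumP => k.
  have sumE (A : J -> dsum (fun k => P_ (x k) z)) :
      (\sum_j A j) k = \sum_j A j k.
    by elim/big_rec2: _ => // j a b _ <-.
  rewrite sumE (bigD1 k) //= big1 => [|j jk].
    rewrite addr0 -[RHS]/((i z v k : R) * (k == k)%:R) eqxx mulr1 //.
  by rewrite -[LHS]/((i z v j : R) * (k == j)%:R) eq_sym (negPf jk) mulr0.
pose A : 'M[K]_(#|I|, #|J|) :=
  \matrix_(k, j) red (i z (u (enum_val k)) (enum_val j)).
pose B : 'M[K]_(#|J|, #|I|) :=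
  \matrix_(j, k) red (c (enum_val k) (g z (dl (enum_val j)))).
have AB : A *m B = 1%:M.
  apply/matrixP => k l; rewrite !mxE.
  have := cu (enum_val k) (enum_val l); rewrite {1}(decomp (u _)).
  rewrite -[LHS]/(mk_linear (cL (enum_val l)) _) linear_sum /=.
  move=> /(congr1 red); rewrite rmorph_sum /= (inj_eq enum_val_inj) rmorph_nat => <-.
  rewrite [RHS](reindex_onto (@enum_val J J) (@enum_rank J)) /=; last first.
    by move=> j _; rewrite enum_rankK.
  rewrite [RHS](eq_bigl xpredT) => [|j]; last by rewrite enum_valK eqxx.
  apply: eq_bigr => j _; rewrite !mxE -rmorphM; congr (red _).
  by rewrite [RHS]linearZ_LR.
rewrite -[#|I|](@mxrank1 K) -AB; apply: leq_trans (mxrankM_maxl _ _) _.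
exact: rank_leq_col.
Qed.

(** A cell split off from the complementary idempotent is orthogonal to the
    cells already found. *)
Lemma extend_orthonormal (V : frob_cat) (I : finType) (p q : I -> S1) s r :
    @orthonormal V I p q s r ->
  is_biproduct (fun i => cell (p i) (q i) : frob_cat) V \/
  exists (p' q' : option I -> S1) s' r', @orthonormal V (option I) p' q' s' r'.
Proof.
move=> [rs1 rs0]; pose e : hom frob_cat V V := idm V - \sum_i comp (s i) (r i).
have [e0|e0] := eqVneq e 0.
  left; exists s, r; split=> //; apply/eqP.
  by rewrite eq_sym -subr_eq0; apply/eqP.
right.
have [es re ee] := complement_idempotent rs1 rs0.
have [p0 [q0 [s0 [r0 [rs es0 r0e]]]]] := split_cell R_dvr t_unif ee e0.
pose p' o := if o is Some i then p i else p0.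
pose q' o := if o is Some i then q i else q0.
exists p', q'.
exists (fun o => match o return hom frob_cat (cell (p' o) (q' o)) V with
  Some i => s i | None => s0 end).
exists (fun o => match o return hom frob_cat V (cell (p' o) (q' o)) with
  Some i => r i | None => r0 end).
split=> [[i|]|[i|] [j|] //= ij]; [exact: rs1 | exact: rs | exact: rs0 | |].
  by rewrite -r0e -[LHS](@compA _ frob_cat) es comp0r.
by rewrite -es0 [LHS](@compA _ frob_cat) re comp0l.
Qed.

Lemma cell_decomposition (V : frob_cat) : exists (I : finType) (p q : I -> S1),
  is_biproduct (fun i => cell (p i) (q i) : frob_cat) V.
Proof.
apply: contrapT => nV.
have [J [x [i [g gi]]]] := projective_retract (fr_fg V) (@fr_proj _ _ _ V).
have fam n : exists (I : finType) (p q : I -> S1) s r,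
    #|I| = n /\ @orthonormal V I p q s r.
  elim: n => [|n [I [p [q [s [r [cI o]]]]]]].
    exists void, (fun=> 0), (fun=> 0), (fun=> 0), (fun=> 0).
    by split; [rewrite card_void | split; case].
  have [bp|[p' [q' [s' [r' o']]]]] := extend_orthonormal o.
    by case: nV; exists I, p, q.
  by exists (option I), p', q', s', r'; rewrite card_option cI.
have [I [p [q [s [r [cI o]]]]]] := fam #|J|.+1.
by have := orthonormal_card gi o; rewrite cI ltnn.
Qed.

Lemma cell_t_zero p q : t *: idm (cell p q : stable_cat RR t) = 0.
Proof.
rewrite -[LHS]/(t *: fmap (stabilize RR t) (fh_id (cell p q))) -linearZ_LR.
rewrite -[RHS](linear0 (fmap (stabilize RR t))).
by apply/stable_classP/stably_zeroP; rewrite subr0; apply: cell_t_null.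
Qed.

(** Multiplication by [t] on the identity of a sum of cells is a sum of maps
    factoring through its null-homotopic action on the cells. *)
Lemma stable_annihilates : annihilates t (stable_cat RR t).
Proof.
move=> X Y f; have [I [p [q bp]]] := cell_decomposition X.
have [s [r [_ _ sr1]]] := biproduct_fmap (stabilize RR t) bp.
rewrite -[f]compm1 -compZr -sr1 scaler_sumr big1 ?comp0r // => i _.
by rewrite -[s i]compm1 -compZl -compZr cell_t_zero comp0r comp0l.
Qed.

Lemma stable_proper_decomposition (W : stable_cat RR t) : exists n (p q : 'I_n -> S1),
  (forall k, p k != q k) /\ is_biproduct (fun k => cell (p k) (q k) : stable_cat RR t) W.
Proof.
have [I [p [q bp]]] := cell_decomposition W.
have := biproduct_fmap (stabilize RR t) bp.
move=> /(@biproduct_support _ _ _ _ _ [pred i | p i != q i])[i|s [r sr]].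
  rewrite inE negbK => /eqP pq.
  rewrite -[RHS](linear0 (fmap (stabilize RR t))).
  apply/stable_classP/stably_zeroP; rewrite subr0.
  case: (q i) / pq; exact: (cell_diag_null (uniformizer_neq0 R_dvr t_unif)).
exists #|[pred i | p i != q i]|, (p \o enum_val), (q \o enum_val).
by split; [move=> k; have := enum_valP k; rewrite inE | exists s, r].
Qed.

End Decomposition.

(** * Pairs of points and the basic morphisms *)

Section Arcs.
Variables (RR : realType) (R : idomainType) (t : R).
Hypothesis t0 : t != 0.
Local Notation S1 := (circle RR).
Local Notation tau := (tau RR).
Local Notation P_ := (P_ t).
Local Notation frob := (frob RR t).
Local Notation ppair := (ppair RR).
Local Notation cell := (cell t).
Implicit Types (X Y Z : ppair).

Definition arc X : RR := ang (pp1 X - pp0 X).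

Lemma label_arc X x y : label X x y -> y = x + arc X.
Proof.
case=> xX yX /andP[h1 h2]; rewrite /arc (@ang_uniq _ _ (y - x)).
- by rewrite addrC subrK.
- by apply/andP; split; lra.
- by rewrite clsB xX yX.
Qed.

Lemma label_ang X : label X (ang (pp0 X)) (ang (pp0 X) + arc X).
Proof.
have [x [y l]] := label_ex X; have := label_arc l; case: l => xX yX h yE.
split; rewrite ?angK //; last by rewrite yE in h; apply/andP; split; lra.
by rewrite clsD !angK addrC subrK.
Qed.

Lemma arc_gt0 X : 0 < arc X.
Proof. by have [_ _] := label_ang X; lra. Qed.
Lemma arc_lt X : arc X < tau. Proof. exact: ang_lt. Qed.

(** Both points of [X] are moved onto those of [Y], by [a] and [b], and neither
    reaches the old position of the other. *)
Lemma gen_falseP X Y : gen false X Y <->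
  exists a b, [/\ arrow (pp0 Y) (pp0 X) a, arrow (pp1 Y) (pp1 X) b,
    a + arc Y = arc X + b, a < arc X & b < tau - arc X].
Proof.
have lX := label_ang X; set x0 := ang (pp0 X) in lX; have [cx0 cx1 _] := lX.
split=> [/(gen_at lX)[y0 [y1 [lY [h1 h2 h3 h4]]]]|[a [b [ha hb ab la lb]]]].
  have y1E := label_arc lY; have [cy0 cy1 _] := lY.
  exists (y0 - x0), (y1 - (x0 + arc X)); split; [| |lra|lra|lra].
    by apply: arrow_add; [lra | rewrite clsB cx0 cy0 addrC subrK].
  by apply: arrow_add; [lra | rewrite clsB cx1 cy1 addrC subrK].
have a0 := arrow_ge0 ha; have b0 := arrow_ge0 hb.
have := arc_gt0 Y; have := arc_lt Y.
exists x0, (x0 + arc X), (x0 + a), (x0 + arc X + b).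
split=> //; last by split; lra.
split; last by apply/andP; split; lra.
  by rewrite clsD cx0 (arrowE ha) subrK.
by rewrite clsD cx1 (arrowE hb) subrK.
Qed.

Definition cell_of X : frob := cell (pp0 X) (pp1 X).

Definition shortest X Y : rep_hom (cell_of X) (cell_of Y) :=
  rh_diag (slide t (arrow_ang (pp0 Y) (pp0 X))) (slide t (arrow_ang (pp1 Y) (pp1 X))).

(** The generator [b_+]. The value [0] is a default for pairs on which moving
    both points by the shortest arcs does not commute with the differentials. *)
Definition bplus X Y : frob_hom (cell_of X) (cell_of Y) :=
  if pselect (forall z v, shortest X Y z (fr_d (cell_of X) z v) =
                          fr_d (cell_of Y) z (shortest X Y z v)) is left h
  then fh_make h else 0.

Lemma shortestE X Y a b (ha : arrow (pp0 Y) (pp0 X) a) (hb : arrow (pp1 Y) (pp1 X) b)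
    (ab : a + arc Y = arc X + b) : a < arc X -> b < tau - arc X ->
  shortest X Y = shift t0 ha hb ab.
Proof.
move=> la lb; have x1 := arc_gt0 X; have x2 := arc_lt X.
have aE : ang (pp0 Y - pp0 X) = a by apply: ang_arrow => //; lra.
have bE : ang (pp1 Y - pp1 X) = b by apply: ang_arrow => //; lra.
by rewrite /shortest (slide_eq t _ ha) // (slide_eq t _ hb).
Qed.

Lemma bplus_val X Y : gen false X Y -> forall z v, bplus X Y z v = shortest X Y z v.
Proof.
move=> /gen_falseP[a [b [ha hb ab la lb]]].
rewrite /bplus; case: pselect => // -[].
by rewrite (shortestE ha hb ab la lb); apply: frob_homC.
Qed.

Lemma bplusE X Y a b (ha : arrow (pp0 Y) (pp0 X) a) (hb : arrow (pp1 Y) (pp1 X) b)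
    (ab : a + arc Y = arc X + b) : a < arc X -> b < tau - arc X ->
  bplus X Y = shift t0 ha hb ab.
Proof.
move=> la lb; apply: frob_homP => z v; rewrite bplus_val ?(shortestE ha hb ab) //.
by apply/gen_falseP; exists a, b.
Qed.

Lemma bplus_id X : bplus X X = fh_id (cell_of X).
Proof.
apply: frob_homP => z [v w]; rewrite bplus_val; last exact: gen_id.
by rewrite /shortest rh_diagE !(slide_eq t _ (arrow_id _)) ?subrr ?ang0 // !slide_id.
Qed.

(** Outside the range of [gen false] one of the points reaches the old position
    of the other, and the homotopies of [shift_null_fst] and [shift_null_snd]
    apply. *)
Lemma shift_bplus X Y a b (ha : arrow (pp0 Y) (pp0 X) a) (hb : arrow (pp1 Y) (pp1 X) b)
    (ab : a + arc Y = arc X + b) :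
  gen false X Y /\ bplus X Y = shift t0 ha hb ab \/ null_homotopic (shift t0 ha hb ab).
Proof.
have [la|la] := ltP a (arc X); last by right; apply: shift_null_fst.
have [lb|lb] := ltP b (tau - arc X); last by right; apply: shift_null_snd.
by left; split; [apply/gen_falseP; exists a, b | apply: bplusE].
Qed.

(** Composing adds the distances. If [gen false X Z] holds, the sum is still
    less than a turn and so is the shortest arc, which makes it the generator. *)
Lemma bplus_comp X Y Z : gen false X Y -> gen false Y Z ->
  (gen false X Z -> fh_comp (bplus Y Z) (bplus X Y) = bplus X Z) /\
  (~ gen false X Z -> null_homotopic (fh_comp (bplus Y Z) (bplus X Y))).
Proof.
move=> /gen_falseP[a [b [ha hb ab la lb]]] /gen_falseP[a' [b' [ha' hb' ab' la' lb']]].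
rewrite (bplusE ha hb ab la lb) (bplusE ha' hb' ab' la' lb').
have ha'' : arrow (pp0 Z) (pp0 X) (a + a') by apply: arrow_comp ha' ha _.
have hb'' : arrow (pp1 Z) (pp1 X) (b + b') by apply: arrow_comp hb' hb _.
have ab'' : a + a' + arc Z = arc X + (b + b') by lra.
rewrite (shift_comp t0 ha hb ha' hb' ha'' hb'' ab ab' ab'') //.
have [[gXZ e]|n] := shift_bplus ha'' hb'' ab''; first by split.
split=> // /gen_falseP[c [d [hc hd cd lc ld]]].
have cE : ang (pp0 Z - pp0 X) = c.
  by apply: ang_arrow => //; have := arc_lt X; lra.
have aE : ang (pp0 Z - pp0 X) = a + a' by apply: ang_arrow => //; lra.
by rewrite (bplusE ha'' hb'' ab'') //; lra.
Qed.

Definition untwist (e : bool) Y : frob_hom (cell_of (pp_twist e Y)) (cell_of Y) :=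
  if e return frob_hom (cell_of (pp_twist e Y)) (cell_of Y)
  then cell_swap t (pp_neq_sym Y) else fh_id (cell_of Y).

(** The generator [b_-] is [b_+] to the pair with its points exchanged, followed
    by the isomorphism between the two cells. *)
Definition generator e X Y : frob_hom (cell_of X) (cell_of Y) :=
  fh_comp (untwist e Y) (bplus X (pp_twist e Y)).

Lemma generator_id X : generator false X X = fh_id (cell_of X).
Proof. by apply: frob_homP => z v; rewrite fh_compE /= bplus_id. Qed.

Lemma bplus_swap X Y : gen false X Y ->
  fh_comp (bplus X Y) (untwist true X) =
  fh_comp (untwist true Y) (bplus (pp_swap X) (pp_swap Y)).
Proof.
move=> g; apply: frob_homP => z v.
by rewrite !fh_compE !cell_swapE !bplus_val //; apply: gen_swap2.
Qed.

(** The exchange isomorphisms commute with [b_+], so they can be collected at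
    the end, where they compose according to the product of the signs. *)
Lemma generator_comp e e' X Y Z : gen e X Y -> gen e' Y Z ->
  (gen (e (+) e') X Z ->
     fh_comp (generator e' Y Z) (generator e X Y) = generator (e (+) e') X Z) /\
  (~ gen (e (+) e') X Z -> null_homotopic (fh_comp (generator e' Y Z) (generator e X Y))).
Proof.
have genE d X' Y' : gen d X' Y' <-> gen false X' (pp_twist d Y').
  by rewrite (gen_twist d false).
move=> /genE gXY /genE gYZ; pose W := pp_twist e (pp_twist e' Z).
have gYW : gen false (pp_twist e Y) W by rewrite /W; case: (e) => //=; apply: gen_swap2.
have gE : gen (e (+) e') X Z <-> gen false X W.
  by rewrite genE /W; case: (e); case: (e'); rewrite //= pp_swapK.
have cE : fh_comp (generator e' Y Z) (generator e X Y) =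
    fh_comp (fh_comp (untwist e' Z) (untwist e (pp_twist e' Z)))
            (fh_comp (bplus (pp_twist e Y) W) (bplus X (pp_twist e Y))).
  rewrite /W; case: (e) gXY gYW => gXY gYW; last exact: frob_homP.
  apply: frob_homP => z v; rewrite !fh_compE.
  have := bplus_swap gYZ => /(congr1 (fun f : frob_hom _ _ => f z (bplus X (pp_swap Y) z v))).
  by rewrite !fh_compE => ->.
have [c1 c2] := bplus_comp gXY gYW; rewrite cE; split=> /gE g.
  rewrite c1 // /generator /W.
  case: (e); case: (e'); apply: frob_homP => z v //.
  by rewrite !fh_compE !cell_swapE; case: (bplus _ _ _ _).
have -> (f : frob_hom (cell_of X) (cell_of W)) :
   fh_comp (fh_comp (untwist e' Z) (untwist e (pp_twist e' Z))) f =
   fh_comp (fh_comp (untwist e' Z) (untwist e (pp_twist e' Z))) (fh_comp f (fh_id _)).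
  exact: frob_homP.
by apply: null_homotopic_comp; apply: c2.
Qed.

Section DiagonalPart.
Variables (p q p' q' : S1) (f : frob_hom (cell p q) (cell p' q')).
Let f0 := rh_comp (rh_fst (P_ p') (P_ q')) (rh_comp f (rh_inl (P_ p) (P_ q))).
Let f1 := rh_comp (rh_snd (P_ p') (P_ q')) (rh_comp f (rh_inr (P_ p) (P_ q))).
Let comm : rh_comp f1 (there t p q) = rh_comp (there t p' q') f0.
Proof.
apply: rep_homP => z v.
have := congr1 snd (frob_homC f ((v, 0) : cell p q z)); rewrite !cell_frE.
have -> : back t p q z (v, 0 : P_ q z).2 = 0 by apply: linear0.
by [].
Qed.
Definition diagonal_part : frob_hom (cell p q) (cell p' q') :=
  @fh_make _ _ _ (cell p q) (cell p' q') (rh_diag f0 f1) (diag_comm t0 comm).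
Lemma diagonal_part_shift : exists c a b (ha : arrow p' p a) (hb : arrow q' q b) ab,
  diagonal_part = c *: shift t0 ha hb ab.
Proof.
have [c [a [b [ha [hb [ab f0E f1E]]]]]] := diag_shift t0 comm.
exists c, a, b, ha, hb, ab; apply: frob_homP => z v.
rewrite fh_ZE shiftE -[LHS]/(f0 z v.1, f1 z v.2).
by congr pair; rewrite (f0E, f1E).
Qed.
End DiagonalPart.

Lemma diagonal_part_bplus X Y (f : frob_hom (cell_of X) (cell_of Y)) :
  (gen false X Y /\ exists c, diagonal_part f = c *: bplus X Y) \/
  null_homotopic (diagonal_part f).
Proof.
have [c [a [b [ha [hb [ab ->]]]]]] := diagonal_part_shift f.
have [[g e]|n] := shift_bplus ha hb ab; first by left; split=> //; exists c; rewrite e.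
right; apply/stably_zeroP; rewrite -[_ *: _]addr0; apply: (stably_zero_closed _ _).2.
  exact/stably_zeroP.
exact: (stably_zero_closed _ _).1.
Qed.

Definition twisted X Y (f : frob_hom (cell_of X) (cell_of Y)) :
    frob_hom (cell_of X) (cell_of (pp_swap Y)) :=
  fh_comp (cell_swap t (pp_neq Y)) f.

(** The antidiagonal of [f] is the diagonal of [f] followed by the exchange. *)
Lemma diagonal_antidiagonal X Y (f : frob_hom (cell_of X) (cell_of Y)) :
  f = diagonal_part f + fh_comp (untwist true Y) (diagonal_part (twisted f)).
Proof.
apply: frob_homP => z [v w].
rewrite -[RHS]/(((f z (v, 0)).1 + (f z (0, w)).1, (f z (0, w)).2 + (f z (v, 0)).2)).
have -> : ((v, w) : cell_of X z) = (v, 0) + (0, w).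
  by congr pair; rewrite ?addr0 ?add0r.
rewrite linearD; case: (f z (v, 0)) (f z (0, w)) => [a b] [c d].
by congr pair; rewrite addrC.
Qed.

End Arcs.

(** * The equivalence *)

Section ClusterFunctor.
Variables (RR : realType) (R : idomainType) (t : R) (K : fieldType).
Hypotheses (R_dvr : is_dvr R) (t_unif : uniformizer t).
Variables (red : residue_map t K) (tC : annihilates t (stable_cat RR t)).
Let t0 : t != 0 := uniformizer_neq0 R_dvr t_unif.
Local Notation ppair := (ppair RR).
Local Notation cell_of := (cell_of t).
Local Notation SC := (residue_cat red tC).
Local Notation generator := (generator t).
Implicit Types (X Y Z : ppair).

Lemma stable_class0 (X Y : frob RR t) (f : frob_hom X Y) :
  stable_class f = 0 <-> null_homotopic f.
Proof.
have -> : (0 : stable_hom X Y) = stable_class 0.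
  by symmetry; apply: (linear0 (@fmap R _ _ (stabilize RR t) X Y)).
by rewrite stable_classP subr0; apply: stably_zeroP.
Qed.

Lemma stable_classZ (X Y : frob RR t) a (f : frob_hom X Y) :
  stable_class (a *: f) = a *: stable_class f.
Proof. exact: qpiZ. Qed.

Definition gen_class X Y : hom SC (cell_of X) (cell_of Y) :=
  stable_class (generator (sgn X Y) X Y).

Lemma untwist_iso X Y (f : frob_hom (cell_of X) (cell_of (pp_swap Y))) :
  null_homotopic (fh_comp (untwist t true Y) f) -> null_homotopic f.
Proof.
move=> h; have -> : f = fh_comp
    (cell_swap t (pp_neq Y) : frob_hom (cell_of Y) (cell_of (pp_swap Y)))
    (fh_comp (fh_comp (untwist t true Y) f) (fh_id _)).
  apply: frob_homP => z v; rewrite !fh_compE !cell_swapE /=.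
  by case: (f z v).
exact: null_homotopic_comp.
Qed.

Lemma gen_class_faithful X Y (c : R) : dimC X Y ->
  c *: stable_class (generator (sgn X Y) X Y) = 0 -> red c = 0.
Proof.
move=> /dimCP; move: (sgn X Y) => e g; rewrite -stable_classZ => /stable_class0 n.
apply/rmap_ker; have {}g : gen false X (pp_twist e Y).
  by move: g; rewrite (gen_twist e false).
have {}n : null_homotopic (c *: bplus t X (pp_twist e Y)).
  case: e n {g} => n; last first.
    by move: n; congr null_homotopic; apply: frob_homP.
  apply: untwist_iso; move: n; congr null_homotopic; apply: frob_homP => z v.
  by rewrite fh_ZE !fh_compE fh_ZE !cell_swapE.
move: g => /gen_falseP[a [b [ha hb ab la lb]]].
rewrite (bplusE t0 ha hb ab la lb) in n.
exact: shift_not_null la lb n.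
Qed.

(** By [gen_exclusive] at most one of the diagonal and the antidiagonal part of a
    morphism can be stably nonzero. *)
Lemma gen_class_full X Y (m : stable_hom (cell_of X) (cell_of Y)) :
  exists c : R, m = c *: stable_class (generator (sgn X Y) X Y) /\
    (~~ dimC X Y -> m = 0).
Proof.
elim/stable_ind: m => f.
pose f1 := diagonal_part t0 f.
pose f2 := diagonal_part t0 (twisted f).
have -> : stable_class f = stable_class f1 + stable_class (fh_comp (untwist t true Y) f2).
  by rewrite {1}(diagonal_antidiagonal t0 f) /stable_class qpiD.
have comp0 : null_homotopic f2 -> null_homotopic (fh_comp (untwist t true Y) f2).
  move=> /(null_homotopic_comp (untwist t true Y) (fh_id _)).
  by congr null_homotopic; apply: frob_homP.
have [[g1 [c cE]]|/stable_class0 ->] := diagonal_part_bplus t0 f.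
  have n2 : null_homotopic f2.
    have [[/gen_swapr g2 _]|//] := diagonal_part_bplus t0 (twisted f).
    by case: (gen_exclusive g1 g2).
  move: (comp0 n2) => /stable_class0 ->; rewrite addr0; exists c.
  split; last by move=> /negP[]; apply/asboolP; left.
  rewrite -stable_classZ (sgnP g1) /f1 cE; congr stable_class.
  exact: frob_homP.
rewrite add0r.
have [[/gen_swapr g2 [c cE]]|/comp0 /stable_class0 ->] :=
  diagonal_part_bplus t0 (twisted f); last by exists 0; rewrite scale0r.
exists c; split; last by move=> /negP[]; apply/asboolP; right.
rewrite -stable_classZ (sgnP g2) /f2 cE; congr stable_class.
by apply: frob_homP => z v; rewrite fh_ZE !fh_compE fh_ZE !cell_swapE.
Qed.

Let Fmap X Y (f : indC_hom K X Y) : hom SC (cell_of X) (cell_of Y) :=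
  coef f *: gen_class X Y.

Let FmapL X Y : linear (@Fmap X Y).
Proof. by move=> a f g; rewrite /Fmap coefP scalerDl scalerA. Qed.

Let Fmap1 X : mk_linear (@FmapL X X) (@idm _ (indC RR K) X) = @idm _ SC (cell_of X).
Proof.
rewrite -[LHS]/(coef (indC_id K X) *: gen_class X X) coef_const.
have -> : dimC X X by apply/asboolP; left; apply: gen_id.
by rewrite scale1r /gen_class (sgnP (gen_id X)) generator_id.
Qed.

Let gen_classM X Y Z : dimC X Y -> dimC Y Z ->
  comp (gen_class Y Z) (gen_class X Y) =
  if `[< gen (sgn X Y (+) sgn Y Z) X Z >] then gen_class X Z else 0.
Proof.
move=> /dimCP gXY /dimCP gYZ; have [c1 c2] := generator_comp t0 gXY gYZ.
rewrite -[LHS]/(stable_comp (stable_class (generator (sgn Y Z) Y Z))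
  (stable_class (generator (sgn X Y) X Y))) stable_compE.
case: asboolP => g; first by rewrite c1 // /gen_class (sgnP g).
exact/stable_class0/c2.
Qed.

Let FmapM X Y Z (g : hom (indC RR K) Y Z) (f : hom (indC RR K) X Y) :
  mk_linear (@FmapL X Z) (comp g f) =
  comp (mk_linear (@FmapL Y Z) g) (mk_linear (@FmapL X Y) f).
Proof.
rewrite -[LHS]/(coef (indC_comp g f) *: gen_class X Z) coef_comp.
rewrite -[RHS]/(comp (coef g *: gen_class Y Z) (coef f *: gen_class X Y)).
rewrite compZl compZr.
have [d1|/(coef0 f) ->] := boolP (dimC X Y); last first.
  by rewrite mulr0 if_same !scale0r scaler0.
have [d2|/(coef0 g) ->] := boolP (dimC Y Z); last first.
  by rewrite mul0r if_same !scale0r.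
rewrite gen_classM //; case: ifP => _; first by rewrite scalerA.
by rewrite !scaler0 scale0r.
Qed.

Definition cluster_functor : linfunctor (indC RR K) SC :=
  @LinFunctor K (indC RR K) SC cell_of (fun X Y => mk_linear (@FmapL X Y)) Fmap1 FmapM.

Lemma residue_scale (X Y : SC) (a : K) (m : hom SC X Y) :
  a *: m = (rlift red a *: (m : stable_hom X Y) : stable_hom X Y).
Proof. by []. Qed.

Lemma cluster_functor_faithful X Y : injective (@fmap K (indC RR K) SC cluster_functor X Y).
Proof.
move=> f g e; apply: coef_inj; apply/eqP; rewrite -subr_eq0; apply/eqP.
have [d|nd] := boolP (dimC X Y); last by rewrite !coef0 // subrr.
rewrite -(rliftK red (coef f - coef g)); apply: (gen_class_faithful d).
rewrite -[LHS]/((coef f - coef g) *: gen_class X Y) scalerBl.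
by apply/eqP; rewrite subr_eq0; apply/eqP.
Qed.

Lemma cluster_functor_full X Y (m : hom SC (cluster_functor X) (cluster_functor Y)) :
  exists f, fmap cluster_functor f = m.
Proof.
have [c [mE m0]] := gen_class_full m; exists (const_mx (red c) : indC_hom K X Y).
rewrite -[LHS]/(coef (const_mx (red c) : indC_hom K X Y) *: gen_class X Y) coef_const.
case: ifPn => [_|/m0 ->]; last exact: scale0r.
rewrite [RHS]mE residue_scale; apply: (@red_scale R t K red (stable_hom (cell_of X) (cell_of Y))).
  exact: tC.
by rewrite rliftK.
Qed.

Lemma residue_biproduct (I : finType) (X : I -> stable_cat RR t) W :
  is_biproduct X W -> @is_biproduct K SC I X W.
Proof. by []. Qed.

Lemma cluster_functor_sum n (X : 'I_n -> indC RR K) :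
  exists W : SC, is_biproduct (fun i => cluster_functor (X i)) W.
Proof.
have [W bp] := frob_biproducts (t := t) (fun i => cell_of (X i) : frob_cat RR t).
exists W; apply: residue_biproduct; exact: (biproduct_fmap (stabilize RR t) bp).
Qed.

Lemma cluster_functor_dec (W : SC) : exists n (X : 'I_n -> indC RR K),
  is_biproduct (fun i => cluster_functor (X i)) W.
Proof.
have [n [p [q [pq bp]]]] := stable_proper_decomposition R_dvr t_unif red W.
by exists n, (fun k => PPair (pq k)); apply: residue_biproduct.
Qed.

End ClusterFunctor.

Theorem theorem3p1p9 (RR : realType) (R : idomainType) (t : R) (K : fieldType)
    (R_dvr : is_dvr R) (t_unif : uniformizer t) (red : residue_map t K) :
  exists tC : annihilates t (stable_cat RR t),
    equivalent_lincat (residue_cat red tC) (cluster_cat RR K).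
Proof.
exists (stable_annihilates (RR := RR) R_dvr t_unif red).
apply: (@equivalent_hull _ _ _ (cluster_functor R_dvr t_unif red _)).
- exact: cluster_functor_faithful.
- exact: cluster_functor_full.
- exact: cluster_functor_sum.
- exact: cluster_functor_dec.
Qed.
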